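(* Let $k$ be a field, $n>0$, $X=\{x_0,\dots,x_n\}$, $Y=\{y_0,\dots,y_n\}$. Let $\Sigma_1=\Sigma'_k(x_0,\dots,x_n)\cup\{(x_0,\dots,x_n)^T\}$. Set $S=k_{\mathrm{rat}}\langle X\rangle\langle Y;\tau,\delta\rangle$, let $I$ be the ideal of $S$ generated by the idempotent $e=1-\sum_{i=0}^n y_ix_i$, and write $T=S/I$. Then $T$ is the universal localization of $k\langle X\rangle$ with respect to $\Sigma_1$. In particular, $T$ is a hereditary algebra. Explicitly, the universal property of $T$ is the following. Suppose that $V$ is a $k$-algebra containing elements $a_0,\dots,a_n$ and $b_0,\dots,b_n$ such that (1) $a_ib_j=\delta_{ij}$ for all $i,j$; (2) $b_0a_0+b_1a_1+\dots+b_na_n=1$; (3) all matrices in $\Sigma'_k(a_0,\dots,a_n)$ are invertible over $V$. Then there exists a unique $k$-algebra homomorphism $\psi:T\to V$ such that $\psi(x_i)=a_i$ for all $i$ and $\psi(y_j)=b_j$ for all $j$.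
   Context: Algebras and homomorphisms are unital. $k\langle X\rangle$ is the free algebra, $k\langle\langle X\rangle\rangle$ the algebra of noncommutative formal power series $\sum_{w\in X^*}\lambda_w w$. The algebra of rational series $k_{\mathrm{rat}}\langle X\rangle$ is the division closure of $k\langle X\rangle$ in $k\langle\langle X\rangle\rangle$: the smallest subalgebra containing $k\langle X\rangle$ such that any of its elements which is invertible in $k\langle\langle X\rangle\rangle$ is invertible in the subalgebra. $\tau$ takes a series to its constant term and $\delta_i\bigl(\sum_w\lambda_w w\bigr)=\sum_w\lambda_{wx_i}w$; $k_{\mathrm{rat}}\langle X\rangle$ is invariant under the $\delta_i$. For $A=k_{\mathrm{rat}}\langle X\rangle$, $A\langle Y;\tau,\delta\rangle$ is the ring containing $A$ as a subring and the free monoid $Y^*$ as a multiplicative submonoid, which is free as a right $A$-module (under ring multiplication) with basis $Y^*$, and in which $ry_i=y_i\tau(r)+\delta_i(r)$ for all $i$ and $r\in A$. For elements $a_0,\dots,a_n$ of a $k$-algebra $V$, $\Sigma'_k(a_0,\dots,a_n)$ denotes the set of square matrices over $V$ of the form $A_0+B$ where $A_0$ is an invertible matrix over $k$ and the entries of $B$ are noncommutative polynomials (over $k$) with zero constant term evaluated at $(a_0,\dots,a_n)$. The universal localization of a ring $A$ with respect to a set of matrices (viewed as maps between free right $A$-modules) is the universal ring homomorphism from $A$ making all of them invertible; here the homomorphism $k\langle X\rangle\to T$ is the natural one. In the universal property, $x_i$ and $y_j$ also denote their images in $T$. *)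

(* Defs.v *)
From HB Require Import structures.
From mathcomp Require Import all_boot all_order all_algebra.
From mathcomp Require Import boolp.
From mathcomp Require Import finmap monalg.
From mathcomp Require Import zify.

Set Implicit Arguments.
Unset Strict Implicit.
Unset Printing Implicit Defensive.

Import GRing.Theory.

Local Open Scope ring_scope.
Local Open Scope quotient_scope.

Definition invertible_mx (R : pzRingType) p q (M : 'M[R]_(p, q)) : Prop :=
  exists N : 'M[R]_(q, p), M *m N = 1%:M /\ N *m M = 1%:M.

(** A set of (possibly rectangular) matrices over [R]; an [m x n] matrix is a
    map of free right modules [R^n -> R^m] acting on columns from the left. *)
Definition mxset (R : pzRingType) : Type := forall p q, 'M[R]_(p, q) -> Prop.

Definition inverts (A B : pzRingType) (f : {rmorphism A -> B})
    (Sigma : mxset A) : Prop :=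
  forall p q (M : 'M[A]_(p, q)), Sigma p q M -> invertible_mx (map_mx f M).

Definition universal_localization (A B : pzRingType) (f : {rmorphism A -> B})
    (Sigma : mxset A) : Prop :=
  inverts f Sigma /\
  forall (C : pzRingType) (g : {rmorphism A -> C}), inverts g Sigma ->
    exists h : {rmorphism B -> C},
      (forall r, h (f r) = g r) /\
      forall h' : {rmorphism B -> C}, (forall r, h' (f r) = g r) -> h' =1 h.

Definition projective (R : pzRingType) (P : lmodType R) : Prop :=
  forall (M N : lmodType R) (g : {linear M -> N}) (f : {linear P -> N}),
    (forall v, exists u, g u = v) ->
    exists f' : {linear P -> M}, forall u, g (f' u) = f u.

Section LeftIdeal.
Context (R : pzRingType) (J : submodClosed R^o).

Record left_ideal := LeftIdeal { ideal_val : R^o; _ : ideal_val \in J }.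

HB.instance Definition _ := [isSub for ideal_val].
HB.instance Definition _ := [Choice of left_ideal by <:].
HB.instance Definition _ := [SubChoice_isSubLmodule of left_ideal by <:].
End LeftIdeal.

Definition left_hereditary (R : pzRingType) : Prop :=
  forall J : submodClosed R^o, projective (left_ideal J).

(** Right ideals and right modules are those on the left of [R^c]. *)
Definition hereditary (R : pzRingType) : Prop :=
  left_hereditary R /\ left_hereditary R^c.

Definition two_sided_ideal (R : pzRingType) (J : {pred R}) : Prop :=
  zmod_closed J /\
  forall a x : R, x \in J -> a * x \in J /\ x * a \in J.

Definition gen_ideal (R : pzRingType) (e : R) : {pred R} :=
  fun x => `[< forall J : {pred R}, two_sided_ideal J -> e \in J -> x \in J >].

Section GenIdeal.
Context (R : pzRingType) (e : R).

Lemma gen_idealP : two_sided_ideal (gen_ideal e).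
Proof.
split; [split|].
- by apply/asboolP=> J [[]].
- move=> x y /asboolP hx /asboolP hy; apply/asboolP=> J hJ eJ.
  by have [[_ hB] _] := hJ; apply: hB; [apply: hx | apply: hy].
- move=> a x /asboolP hx; split; apply/asboolP=> J hJ eJ;
  by have [_ /(_ a x (hx J hJ eJ)) []] := hJ.
Qed.

Lemma mem_gen_ideal : e \in gen_ideal e.
Proof. by apply/asboolP. Qed.

Fact gen_ideal_zmod : zmod_closed (gen_ideal e).
Proof. by case: gen_idealP. Qed.

HB.instance Definition _ :=
  GRing.isZmodClosed.Build R (gen_ideal e) gen_ideal_zmod.
End GenIdeal.

Lemma one_sub_sum_idem (R : pzRingType) m (x y : 'I_m -> R) :
  (forall i j, x i * y j = (i == j)%:R) ->
  let e := 1 - \sum_i y i * x i in e * e = e.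
Proof.
move=> xy /=; set s := \sum_i _.
have xs i : x i * s = x i.
  rewrite mulr_sumr (bigD1 i) //= mulrA xy eqxx mul1r big1 ?addr0 // => j nji.
  by rewrite mulrA xy eq_sym (negPf nji) mul0r.
have ss : s * s = s.
  by rewrite {1}/s mulr_suml; apply: eq_bigr => i _; rewrite -mulrA xs.
by rewrite mulrBl mul1r mulrBr mulr1 ss subrr subr0.
Qed.

Section Algebras.
Context (k : fieldType) (n : nat).
Local Notation I := 'I_n.+1.
Local Notation word := (seq I).
Implicit Types (i j : I) (v w : word).

Definition ncpoly : Type := {malg k[{fmonom I}]}.
HB.instance Definition _ := GRing.Lalgebra.on ncpoly.

Fact ncpoly_scaleAr (c : k) (p q : ncpoly) : c *: (p * q) = p * (c *: q).
Proof.
have cC (r : ncpoly) : r * (<< c *g mone >> : ncpoly) = c *: r.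
  apply/malgP=> w; rewrite mcoeffZ [r * _]fgmulgU raddf_sum /=.
  rewrite [in RHS](monalgE r) raddf_sum mulr_sumr; apply: eq_bigr=> u _ /=.
  by rewrite !mcoeffU mulm1 mulrC mulrnAr.
have -> : c *: q = (<< c *g mone >> : ncpoly) * q by rewrite mul_malgC.
by rewrite mulrA cC scalerAl.
Qed.

HB.instance Definition _ :=
  GRing.Lalgebra_isAlgebra.Build k ncpoly ncpoly_scaleAr.

Definition xpoly i : ncpoly := << FMonom [:: i] >>.

Definition nceval (V : algType k) (a : I -> V) (p : ncpoly) : V :=
  mmap (in_alg V) (fun w : {fmonom I} => \prod_(i <- w) a i) p.

Definition pconst (p : ncpoly) : k := p@_(FMonom [::]).

(** Sigma'_k(a_0, ..., a_n), one size [m] at a time; the polynomial entries of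
    [B] have zero constant term before they are evaluated at the [a_i]. *)
Definition Sigma' (V : algType k) (a : I -> V) m (M : 'M[V]_m) : Prop :=
  exists (A0 : 'M[k]_m) (B : 'M[ncpoly]_m),
    [/\ A0 \in unitmx, (forall r c : 'I_m, pconst (B r c) = 0)
      & M = map_mx (in_alg V) A0 + map_mx (nceval a) B].

Record ncseries : Type := NcSeries { scoef : word -> k }.

HB.instance Definition _ := [isNew for scoef].
HB.instance Definition _ := [Choice of ncseries by <:].

Implicit Types f g h : ncseries.

Lemma ncseriesP f g : (forall w, scoef f w = scoef g w) <-> f = g.
Proof.
split=> [|-> //]; case: f g => [f] [g] /= fg; congr NcSeries.
exact/funext.
Qed.

Definition ns_zero := NcSeries (fun=> 0).
Definition ns_opp f := NcSeries (fun w => - scoef f w).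
Definition ns_add f g := NcSeries (fun w => scoef f w + scoef g w).

Fact ns_addA : associative ns_add.
Proof. by move=> f g h; apply/ncseriesP=> w /=; rewrite addrA. Qed.
Fact ns_addC : commutative ns_add.
Proof. by move=> f g; apply/ncseriesP=> w /=; rewrite addrC. Qed.
Fact ns_add0 : left_id ns_zero ns_add.
Proof. by move=> f; apply/ncseriesP=> w /=; rewrite add0r. Qed.
Fact ns_addN : left_inverse ns_zero ns_opp ns_add.
Proof. by move=> f; apply/ncseriesP=> w /=; rewrite addNr. Qed.

HB.instance Definition _ :=
  GRing.isZmodule.Build ncseries ns_addA ns_addC ns_add0 ns_addN.

Lemma scoef0 w : scoef 0 w = 0. Proof. by []. Qed.
Lemma scoefN f w : scoef (- f) w = - scoef f w. Proof. by []. Qed.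
Lemma scoefD f g w : scoef (f + g) w = scoef f w + scoef g w.
Proof. by []. Qed.

Definition ns_one := NcSeries (fun w => (w == [::])%:R).

Definition ns_mul f g := NcSeries (fun w =>
  \sum_(l < (size w).+1) scoef f (take l w) * scoef g (drop l w)).

Definition lquot i f := NcSeries (fun w => scoef f (i :: w)).

Lemma ns_mul_nil f g :
  scoef (ns_mul f g) [::] = scoef f [::] * scoef g [::].
Proof. by rewrite /= big_ord_recl big_ord0 addr0. Qed.

Lemma ns_mul_cons f g i w :
  scoef (ns_mul f g) (i :: w) =
  scoef f [::] * scoef g (i :: w) + scoef (ns_mul (lquot i f) g) w.
Proof. by rewrite /= big_ord_recl. Qed.

Lemma lquot_mul i f g :
  lquot i (ns_mul f g) =
  ns_add (NcSeries (fun w => scoef f [::] * scoef (lquot i g) w))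
         (ns_mul (lquot i f) g).
Proof. by apply/ncseriesP=> w; rewrite [LHS]ns_mul_cons. Qed.

Fact ns_mulDl : left_distributive ns_mul +%R.
Proof.
move=> f g h; apply/ncseriesP=> w.
rewrite scoefD /= -big_split /=; apply: eq_bigr=> l _.
by rewrite mulrDl.
Qed.

Fact ns_mulDr : right_distributive ns_mul +%R.
Proof.
move=> f g h; apply/ncseriesP=> w.
rewrite scoefD /= -big_split /=; apply: eq_bigr=> l _.
by rewrite mulrDr.
Qed.

Lemma ns_mulZ (c : k) f g w :
  scoef (ns_mul (NcSeries (fun w => c * scoef f w)) g) w =
  c * scoef (ns_mul f g) w.
Proof. by rewrite /= mulr_sumr; apply: eq_bigr=> l _; rewrite mulrA. Qed.

Fact ns_mulA : associative ns_mul.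
Proof.
move=> f g h; apply/ncseriesP=> w; elim: w f g h => [|i w IHw] f g h.
  by rewrite !ns_mul_nil mulrA.
rewrite [LHS]ns_mul_cons [RHS]ns_mul_cons lquot_mul.
rewrite [ns_mul (ns_add _ _) h]ns_mulDl scoefD ns_mulZ -IHw.
by rewrite ns_mul_nil ns_mul_cons mulrDr !mulrA addrA.
Qed.

Fact ns_mul1 : left_id ns_one ns_mul.
Proof.
move=> f; apply/ncseriesP=> -[|i w].
  by rewrite ns_mul_nil /= mul1r.
by rewrite ns_mul_cons /= mul1r big1 ?addr0 // => l _; rewrite mul0r.
Qed.

Fact ns_mulr1 : right_id ns_one ns_mul.
Proof.
move=> f; apply/ncseriesP=> w; elim: w f => [|i w IHw] f.
  by rewrite ns_mul_nil /= mulr1.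
by rewrite ns_mul_cons IHw /= mulr0 add0r.
Qed.

Fact ns_one_neq0 : ns_one != 0.
Proof.
by apply/eqP=> /ncseriesP/(_ [::]) /eqP; rewrite /= oner_eq0.
Qed.

HB.instance Definition _ := GRing.Zmodule_isNzRing.Build ncseries
  ns_mulA ns_mul1 ns_mulr1 ns_mulDl ns_mulDr ns_one_neq0.

Definition ns_scale (c : k) f := NcSeries (fun w => c * scoef f w).

Fact ns_scaleA (a b : k) f : ns_scale a (ns_scale b f) = ns_scale (a * b) f.
Proof. by apply/ncseriesP=> w /=; rewrite mulrA. Qed.
Fact ns_scale1 : left_id 1 ns_scale.
Proof. by move=> f; apply/ncseriesP=> w /=; rewrite mul1r. Qed.
Fact ns_scaleDr : right_distributive ns_scale +%R.
Proof. by move=> c f g; apply/ncseriesP=> w /=; rewrite mulrDr. Qed.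
Fact ns_scaleDl f : {morph ns_scale^~ f : a b / a + b}.
Proof. by move=> a b; apply/ncseriesP=> w /=; rewrite mulrDl. Qed.

HB.instance Definition _ := GRing.Zmodule_isLmodule.Build k ncseries
  ns_scaleA ns_scale1 ns_scaleDr ns_scaleDl.

Lemma scoefZ (c : k) f w : scoef (c *: f) w = c * scoef f w.
Proof. by []. Qed.

Fact ns_scaleAl (c : k) f g : c *: (f * g) = (c *: f) * g.
Proof. by apply/ncseriesP=> w; rewrite ns_mulZ. Qed.

HB.instance Definition _ :=
  GRing.Lmodule_isLalgebra.Build k ncseries ns_scaleAl.

Fact ns_scaleAr (c : k) f g : c *: (f * g) = f * (c *: g).
Proof.
apply/ncseriesP=> w; rewrite /= mulr_sumr; apply: eq_bigr=> l _.
by rewrite mulrCA.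
Qed.

HB.instance Definition _ :=
  GRing.Lalgebra_isAlgebra.Build k ncseries ns_scaleAr.

Lemma scoefM f g w : scoef (f * g) w =
  \sum_(l < (size w).+1) scoef f (take l w) * scoef g (drop l w).
Proof. by []. Qed.

Lemma scoef1 w : scoef 1 w = (w == [::])%:R. Proof. by []. Qed.

Lemma scoefM_nil f g : scoef (f * g) [::] = scoef f [::] * scoef g [::].
Proof. exact: ns_mul_nil. Qed.

Definition poly_series (p : ncpoly) : ncseries :=
  NcSeries (fun w => p@_(FMonom w)).

Fact poly_series_zmod : zmod_morphism poly_series.
Proof. by move=> p q; apply/ncseriesP=> w /=; rewrite mcoeffB. Qed.

HB.instance Definition _ :=
  GRing.isZmodMorphism.Build ncpoly ncseries poly_series poly_series_zmod.

Fact poly_series_scalable : scalable poly_series.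
Proof. by move=> c p; apply/ncseriesP=> w /=; rewrite mcoeffZ. Qed.

HB.instance Definition _ := GRing.isScalable.Build k ncpoly ncseries _
  poly_series poly_series_scalable.

Lemma poly_seriesU (c : k) (u : {fmonom I}) w :
  scoef (poly_series << c *g u >>) w = c *+ (fmonom_val u == w).
Proof. by rewrite /= mcoeffU. Qed.

Lemma poly_series_mulUU (c d : k) (u v : {fmonom I}) :
  poly_series (<< c *g u >> * << d *g v >>) =
  poly_series << c *g u >> * poly_series << d *g v >>.
Proof.
rewrite [_ * _]fgmulUU; apply/ncseriesP=> w; rewrite poly_seriesU fmM scoefM.
under eq_bigr => l _ do rewrite !poly_seriesU mulrnAl mulrnAr -mulrnA mulnb.
case: eqP => [<-|uvw]; last first.
  rewrite big1 // => l _; case: eqP => //= vl; case: eqP => //= ul.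
  by case: uvw; rewrite /= ul vl cat_take_drop.
have lt_u : (size u < (size (u ++ v)).+1)%N by rewrite ltnS size_cat leq_addr.
rewrite (bigD1 (Ordinal lt_u)) //= take_size_cat // drop_size_cat // !eqxx.
rewrite big1 ?addr0 // => l /eqP neq_l; case: eqP => //= eq_v.
case: neq_l; apply/val_inj; move: (congr1 size eq_v) (ltn_ord l) => /=.
by rewrite size_drop; move: (nat_of_ord l) => m; rewrite size_cat; lia.
Qed.

Fact poly_series_monoid : monoid_morphism poly_series.
Proof.
split=> [|p q].
  by apply/ncseriesP=> w /=; rewrite mcoeff1 -val_eqE /= fm1.
rewrite [in LHS](monalgE p) [in LHS](monalgE q) [in RHS](monalgE p).
rewrite [in RHS](monalgE q).
rewrite mulr_suml !raddf_sum mulr_suml; apply: eq_bigr=> u _.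
rewrite !mulr_sumr raddf_sum; apply: eq_bigr=> v _.
exact: poly_series_mulUU.
Qed.

HB.instance Definition _ := GRing.isMonoidMorphism.Build ncpoly ncseries
  poly_series poly_series_monoid.

Definition division_closed (P : {pred ncseries}) : Prop :=
  forall f g, f \in P -> f * g = 1 -> g * f = 1 -> g \in P.

Definition rational : {pred ncseries} := fun f =>
  `[< forall P : {pred ncseries}, GRing.subalg_closed P ->
        (forall p, poly_series p \in P) -> division_closed P -> f \in P >].

Fact rational_subalg : GRing.subalg_closed rational.
Proof.
split.
- by apply/asboolP=> P [].
- move=> c f g /asboolP hf /asboolP hg; apply/asboolP=> P hP pP dP.
  by have [_ h _] := hP; apply: h; [apply: hf | apply: hg].
- move=> f g /asboolP hf /asboolP hg; apply/asboolP=> P hP pP dP.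
  by have [_ _ h] := hP; apply: h; [apply: hf | apply: hg].
Qed.

HB.instance Definition _ :=
  GRing.isSubalgClosed.Build k ncseries rational rational_subalg.

Lemma rational_poly p : poly_series p \in rational.
Proof. by apply/asboolP=> P _ + _; apply. Qed.

Lemma rational_div : division_closed rational.
Proof.
move=> f g /asboolP hf fg gf; apply/asboolP=> P hP pP dP.
exact: dP (hf P hP pP dP) fg gf.
Qed.

(** k_rat<X>, the division closure of k<X> in k<<X>>. *)
Record ratser : Type := RatSer { ratval : ncseries; _ : ratval \in rational }.

HB.instance Definition _ := [isSub for ratval].
HB.instance Definition _ := [Choice of ratser by <:].
HB.instance Definition _ := [SubChoice_isSubAlgebra of ratser by <:].

Lemma ratvalP (r : ratser) : ratval r \in rational. Proof. exact: valP. Qed.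

Definition poly_rat (p : ncpoly) : ratser := RatSer (rational_poly p).

Fact poly_rat_zmod : zmod_morphism poly_rat.
Proof. by move=> p q; apply/val_inj; rewrite /= raddfB. Qed.
HB.instance Definition _ :=
  GRing.isZmodMorphism.Build ncpoly ratser poly_rat poly_rat_zmod.

Fact poly_rat_monoid : monoid_morphism poly_rat.
Proof. by split=> [|p q]; apply/val_inj; rewrite /= ?rmorph1 ?rmorphM. Qed.
HB.instance Definition _ :=
  GRing.isMonoidMorphism.Build ncpoly ratser poly_rat poly_rat_monoid.

Fact poly_rat_scalable : scalable poly_rat.
Proof. by move=> c p; apply/val_inj; rewrite /= linearZ. Qed.
HB.instance Definition _ :=
  GRing.isScalable.Build k ncpoly ratser _ poly_rat poly_rat_scalable.

Definition tau (r : ratser) : k := scoef (ratval r) [::].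

Definition transduction i f := NcSeries (fun w => scoef f (rcons w i)).

Lemma transductionM i f g :
  transduction i (f * g) =
  f * transduction i g + scoef g [::] *: transduction i f.
Proof.
apply/ncseriesP=> w; rewrite scoefD scoefZ /= size_rcons big_ord_recr /=.
rewrite take_oversize ?size_rcons // drop_oversize ?size_rcons // mulrC.
congr (_ + _); apply: eq_bigr => l _.
have le_l : (l <= size w)%N by rewrite -ltnS.
by rewrite drop_rcons // -cats1 takel_cat.
Qed.

Lemma transductionD i f g :
  transduction i (f + g) = transduction i f + transduction i g.
Proof. by []. Qed.

Lemma transductionZ i c f : transduction i (c *: f) = c *: transduction i f.
Proof. by []. Qed.

Lemma transduction1 i : transduction i 1 = 0.
Proof. by apply/ncseriesP=> -[|j w]. Qed.

Lemma transduction_poly i (p : ncpoly) :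
  exists q, transduction i (poly_series p) = poly_series q.
Proof.
rewrite (monalgE p); elim/big_ind: _ => [|p1 p2 [q1 h1] [q2 h2]|u _].
- by exists 0; apply/ncseriesP=> w; rewrite /= !mcoeff0.
- by exists (q1 + q2); rewrite !raddfD /= transductionD h1 h2.
- move uE: (fmonom_val u) => t; case/lastP: t uE => [|v j] uE.
    exists 0; apply/ncseriesP=> w; rewrite raddf0 scoef0 [LHS]poly_seriesU uE.
    by case: w.
  exists << p@_u *+ (j == i) *g FMonom v >>; apply/ncseriesP=> w.
  rewrite [LHS]poly_seriesU poly_seriesU uE /= eqseq_rcons andbC -mulrnA.
  by rewrite mulnb.
Qed.

Lemma rational_transduction i f :
  f \in rational -> transduction i f \in rational.
Proof.
move=> /asboolP hf.
pose P : {pred ncseries} :=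
  [pred g | (g \in rational) && (transduction i g \in rational)].
suff: f \in P by case/andP.
apply: hf.
- split.
  + by rewrite inE transduction1 rpred0 rpred1.
  + move=> c g h /andP[gr tg] /andP[hr th]; rewrite inE.
    by rewrite transductionD transductionZ !rpredD ?rpredZ.
  + move=> g h /andP[gr tg] /andP[hr th]; rewrite inE transductionM.
    by rewrite rpredM //= rpredD ?rpredZ ?rpredM.
- move=> p; rewrite inE rational_poly /=.
  by have [q ->] := transduction_poly i p; exact: rational_poly.
- move=> g h /andP[gr tg] gh hg; have hr := rational_div gr gh hg.
  rewrite inE hr /=.
  have: transduction i (g * h) = 0 by rewrite gh transduction1.
  rewrite transductionM => /(congr1 ( *%R h)).
  rewrite mulr0 mulrDr mulrA hg mul1r => /eqP; rewrite addr_eq0 => /eqP ->.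
  by rewrite rpredN rpredM ?rpredZ.
Qed.

Definition delta i (r : ratser) : ratser :=
  RatSer (rational_transduction i (ratvalP r)).

Lemma tauD r s : tau (r + s) = tau r + tau s. Proof. by []. Qed.
Lemma tau1 : tau 1 = 1. Proof. by rewrite /tau scoef1. Qed.
Lemma tauM r s : tau (r * s) = tau r * tau s.
Proof. exact: scoefM_nil. Qed.
Lemma tauZ c r : tau (c *: r) = c * tau r. Proof. by []. Qed.
Lemma deltaD i r s : delta i (r + s) = delta i r + delta i s.
Proof. exact/val_inj. Qed.
Lemma deltaZ i c r : delta i (c *: r) = c *: delta i r.
Proof. exact/val_inj. Qed.
Lemma delta1 i : delta i 1 = 0.
Proof. by apply/val_inj; rewrite /= transduction1. Qed.
Lemma deltaM i r s : delta i (r * s) = r * delta i s + tau s *: delta i r.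
Proof. by apply/val_inj; rewrite /= transductionM. Qed.

(** [skew] is [S = k_rat<X><Y; tau, delta>]: finitely supported families of
    coefficients in k_rat<X>, indexed by the words in [Y].  The monomial
    [<< r *g w >>] stands for [y_w r], so that [Y^*] is a basis of [S] as a
    right module; see [skewE], [y_ratSE] and [ratS_y] below. *)
Definition skew : Type := {malg (ratser)[word]}.
HB.instance Definition _ := GRing.Zmodule.on skew.

Definition smono w (r : ratser) : skew := << r *g w >>.

(** The product [(y_u r) (y_v c)], computed with
    [r y_i = y_i tau(r) + delta_i(r)]. *)
Fixpoint ymul u (r : ratser) v (c : ratser) : skew :=
  if v is i :: v' then
    smono (u ++ v) (tau r *: c) + ymul u (delta i r) v' c
  else smono u (r * c).

Definition skew_mul (s t : skew) : skew :=
  \sum_(u <- msupp s) \sum_(v <- msupp t) ymul u s@_u v t@_v.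

Definition skew_one : skew := smono [::] 1.

Definition skew_scale (a : k) (s : skew) : skew :=
  [malg u in msupp s => a *: s@_u].

Lemma smonoD w r r' : smono w (r + r') = smono w r + smono w r'.
Proof. exact: monalgUD. Qed.

Lemma skew_ind (P : skew -> Prop) : P 0 ->
  (forall s t, P s -> P t -> P (s + t)) -> (forall w r, P (smono w r)) ->
  forall s, P s.
Proof.
move=> P0 PD PU s; rewrite (monalgE s).
by elim/big_ind: _ => // w _; apply: PU.
Qed.

Section Extension.
Context (G : zmodType) (F : word -> ratser -> G).
Hypothesis FD : forall w, {morph F w : r r' / r + r'}.

Let F0 w : F w 0 = 0.
Proof. by apply: (addrI (F w 0)); rewrite -FD !addr0. Qed.

Definition lext (s : skew) : G := \sum_(u <- msupp s) F u s@_u.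

Lemma lextw (d : {fset word}) s :
  fsubset (msupp s) d -> lext s = \sum_(u <- d) F u s@_u.
Proof.
by move=> le; apply: big_fset_incl => // u _ /mcoeff_outdom ->; exact: F0.
Qed.

Lemma lextU w r : lext (smono w r) = F w r.
Proof. by rewrite (lextw msuppU_le) big_seq_fset1 mcoeffUU. Qed.

Lemma lextD : {morph lext : s t / s + t}.
Proof.
move=> s t; pose d := fsetU (msupp s) (msupp t).
rewrite (@lextw d s) ?fsubsetUl // (@lextw d t) ?fsubsetUr //.
rewrite (@lextw d) ?msuppD_le // -big_split; apply: eq_bigr=> u _.
by rewrite mcoeffD FD.
Qed.
End Extension.

Lemma ymulDl u v c : {morph (fun r => ymul u r v c) : r r' / r + r'}.
Proof.
elim: v => [|i v IHv] r r' /=; first by rewrite mulrDl smonoD.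
by rewrite tauD scalerDl smonoD deltaD IHv addrACA.
Qed.

Lemma ymulDr u r v : {morph (ymul u r v) : c c' / c + c'}.
Proof.
elim: v r => [|i v IHv] r c c' /=; first by rewrite mulrDr smonoD.
by rewrite scalerDr smonoD IHv addrACA.
Qed.

Lemma ymulZ u (a : k) r v c : ymul u (a *: r) v c = ymul u r v (a *: c).
Proof.
elim: v r => [|i v IHv] r /=; first by rewrite -scalerAl scalerAr.
by rewrite tauZ scalerA mulrC deltaZ IHv.
Qed.

Lemma skew_mulDr (s : skew) : {morph (skew_mul s) : t t' / t + t'}.
Proof.
move=> t t'; rewrite /skew_mul -big_split; apply: eq_bigr=> u _ /=.
exact: (@lextD _ (ymul u s@_u) (fun v => ymulDr u s@_u v)).
Qed.

Lemma skew_mulDl (t : skew) : {morph skew_mul^~ t : s s' / s + s'}.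
Proof.
move=> s s'.
apply: (@lextD _ (fun u r => \sum_(v <- msupp t) ymul u r v t@_v)) => u r r'.
by rewrite -big_split; apply: eq_bigr=> v _; exact: ymulDl.
Qed.

Lemma skew_mulUU u r v c : skew_mul (smono u r) (smono v c) = ymul u r v c.
Proof.
rewrite [LHS](@lextU _ (fun u r => \sum_(w <- _) ymul u r w _)).
  exact: (@lextU _ (ymul u r) (fun v => ymulDr u r v)).
by move=> w a a'; rewrite -big_split; apply: eq_bigr=> v' _; exact: ymulDl.
Qed.

Lemma skew_mul0s : left_zero 0 skew_mul.
Proof. by move=> t; rewrite /skew_mul msupp0 big_seq_fset0. Qed.

Lemma skew_muls0 : right_zero 0 skew_mul.
Proof.
by move=> s; apply: (addrI (skew_mul s 0)); rewrite -skew_mulDr !addr0.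
Qed.

Lemma skew_mul_nil u r c w d :
  skew_mul (smono u r) (ymul [::] c w d) = ymul u (r * c) w d.
Proof.
elim: w c => [|i w IHw] c /=; first by rewrite skew_mulUU /= mulrA.
rewrite skew_mulDr skew_mulUU IHw /= tauM deltaM scalerA -addrA; congr (_ + _).
by rewrite ymulDl ymulZ addrC.
Qed.

Lemma skew_mul_cons u r i v c w d :
  skew_mul (smono u r) (ymul (i :: v) c w d) =
  ymul (u ++ i :: v) (tau r *: c) w d
  + skew_mul (smono u (delta i r)) (ymul v c w d).
Proof.
elim: w c => [|j w IHw] c; first by rewrite !skew_mulUU /= scalerAl.
rewrite [in LHS]/= !skew_mulDr IHw !skew_mulUU /=.
by rewrite tauZ deltaZ scalerA -catA /= addrACA.
Qed.

Fact skew_mulA : associative skew_mul.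
Proof.
have core u r v c w d :
    skew_mul (smono u r) (ymul v c w d) = skew_mul (ymul u r v c) (smono w d).
  elim: v r => [|i v IHv] r /=; first by rewrite skew_mulUU skew_mul_nil.
  by rewrite skew_mul_cons IHv skew_mulDl skew_mulUU.
elim/skew_ind => [|s s' Hs Hs'|u r] t t'; first by rewrite !skew_mul0s.
  by rewrite !skew_mulDl Hs Hs'.
elim/skew_ind: t => [|t1 t2 H1 H2|v c]; first by rewrite !(skew_muls0, skew_mul0s).
  by rewrite !(skew_mulDl, skew_mulDr) H1 H2.
elim/skew_ind: t' => [|t1 t2 H1 H2|w d]; first by rewrite !skew_muls0.
  by rewrite !skew_mulDr H1 H2.
by rewrite !skew_mulUU core.
Qed.

Fact skew_mul1s : left_id skew_one skew_mul.
Proof.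
have ymul0 u v c : ymul u 0 v c = 0.
  by apply: (addrI (ymul u 0 v c)); rewrite -ymulDl !addr0.
elim/skew_ind => [|s t Hs Ht|[|i v] c]; first exact: skew_muls0.
- by rewrite skew_mulDr Hs Ht.
- by rewrite skew_mulUU /= mul1r.
- by rewrite skew_mulUU /= tau1 scale1r delta1 ymul0 addr0.
Qed.

Fact skew_muls1 : right_id skew_one skew_mul.
Proof.
elim/skew_ind => [|s t Hs Ht|v c]; first exact: skew_mul0s.
- by rewrite skew_mulDl Hs Ht.
- by rewrite skew_mulUU /= mulr1.
Qed.

Fact skew_one_neq0 : skew_one != 0.
Proof. by rewrite monalgU_eq0 oner_eq0. Qed.

HB.instance Definition _ := GRing.Zmodule_isNzRing.Build skew
  skew_mulA skew_mul1s skew_muls1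
  (fun s s' t => skew_mulDl t s s') skew_mulDr skew_one_neq0.

Lemma coef_scale a (s : skew) w : (skew_scale a s)@_w = a *: s@_w.
Proof. by rewrite mcoeffE; case: msuppP; rewrite ?scaler0. Qed.

Fact skew_scaleA a b s : skew_scale a (skew_scale b s) = skew_scale (a * b) s.
Proof. by apply/malgP=> w; rewrite !coef_scale scalerA. Qed.
Fact skew_scale1 : left_id 1 skew_scale.
Proof. by move=> s; apply/malgP=> w; rewrite coef_scale scale1r. Qed.
Fact skew_scaleDr : right_distributive skew_scale +%R.
Proof.
by move=> a s t; apply/malgP=> w; rewrite mcoeffD !coef_scale mcoeffD scalerDr.
Qed.
Fact skew_scaleDl s : {morph skew_scale^~ s : a b / a + b}.
Proof.
by move=> a b; apply/malgP=> w; rewrite mcoeffD !coef_scale scalerDl.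
Qed.

HB.instance Definition _ := GRing.Zmodule_isLmodule.Build k skew
  skew_scaleA skew_scale1 skew_scaleDr skew_scaleDl.

Lemma smonoZ a w r : a *: smono w r = smono w (a *: r).
Proof.
apply/malgP=> v; rewrite [LHS]coef_scale !mcoeffU.
by case: eqP; rewrite ?scaler0.
Qed.

Lemma ymul_scale a u r v c : a *: ymul u r v c = ymul u r v (a *: c).
Proof.
elim: v r => [|i v IHv] r /=; first by rewrite smonoZ scalerAr.
by rewrite scalerDr smonoZ IHv !scalerA mulrC.
Qed.

Fact skew_scaleAl a (s t : skew) : a *: (s * t) = (a *: s) * t.
Proof.
elim/skew_ind: s => [|s s' Hs Hs'|u r]; first by rewrite mul0r !scaler0 mul0r.
  by rewrite scalerDr !mulrDl scalerDr Hs Hs'.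
elim/skew_ind: t => [|t t' Ht Ht'|v c]; first by rewrite !mulr0 scaler0.
  by rewrite !mulrDr scalerDr Ht Ht'.
by rewrite smonoZ ![smono _ _ * _]skew_mulUU ymul_scale ymulZ.
Qed.

HB.instance Definition _ :=
  GRing.Lmodule_isLalgebra.Build k skew skew_scaleAl.

Fact skew_scaleAr a (s t : skew) : a *: (s * t) = s * (a *: t).
Proof.
elim/skew_ind: s => [|s s' Hs Hs'|u r]; first by rewrite !mul0r scaler0.
  by rewrite !mulrDl scalerDr Hs Hs'.
elim/skew_ind: t => [|t t' Ht Ht'|v c]; first by rewrite !mulr0 !scaler0 mulr0.
  by rewrite scalerDr !mulrDr scalerDr Ht Ht'.
by rewrite smonoZ ![smono _ _ * _]skew_mulUU ymul_scale.
Qed.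

HB.instance Definition _ :=
  GRing.Lalgebra_isAlgebra.Build k skew skew_scaleAr.

Definition ratS (r : ratser) : skew := smono [::] r.
Definition yS i : skew := smono [:: i] 1.

Fact ratS_zmod : zmod_morphism ratS.
Proof. by move=> r s; exact: monalgUB. Qed.
HB.instance Definition _ :=
  GRing.isZmodMorphism.Build ratser skew ratS ratS_zmod.

Fact ratS_monoid : monoid_morphism ratS.
Proof. by split=> // r s; rewrite [RHS]skew_mulUU. Qed.
HB.instance Definition _ :=
  GRing.isMonoidMorphism.Build ratser skew ratS ratS_monoid.

Fact ratS_scalable : scalable ratS.
Proof. by move=> a r; rewrite smonoZ. Qed.
HB.instance Definition _ :=
  GRing.isScalable.Build k ratser skew _ ratS ratS_scalable.

Lemma ratS_y r i : ratS r * yS i = yS i * ratS (tau r)%:A + ratS (delta i r).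
Proof.
rewrite [ratS r * _]skew_mulUU [yS i * _]skew_mulUU /=.
by rewrite mul1r mulr1.
Qed.

Lemma y_ratSE w r : (\prod_(i <- w) yS i) * ratS r = smono w r.
Proof.
elim: w => [|i w IHw]; first by rewrite big_nil mul1r.
rewrite big_cons -mulrA IHw [LHS]skew_mulUU.
case: w {IHw} => [|j w] /=; first by rewrite mul1r.
rewrite tau1 scale1r delta1 -[RHS]addr0; congr (_ + _).
by apply: (addrI (ymul [:: i] 0 w r)); rewrite -ymulDl !addr0.
Qed.

Lemma skewE (s : skew) :
  s = \sum_(w <- msupp s) (\prod_(i <- w) yS i) * ratS s@_w.
Proof. by rewrite {1}(monalgE s); apply: eq_bigr=> w _; rewrite y_ratSE. Qed.

Definition xS i : skew := ratS (poly_rat (xpoly i)).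

Definition skew_e : skew := 1 - \sum_i yS i * xS i.

Lemma tau_x i : tau (poly_rat (xpoly i)) = 0.
Proof. by rewrite /tau /= mcoeffU. Qed.

Lemma delta_x i j : delta j (poly_rat (xpoly i)) = (i == j)%:R.
Proof.
apply/val_inj/ncseriesP=> w.
have -> : val ((i == j)%:R : ratser) = (i == j)%:R by rewrite rmorph_nat.
rewrite /= mcoeffU -val_eqE /= -[[:: i]]/(rcons [::] i) eqseq_rcons.
by case: (i == j); case: w.
Qed.

Lemma xS_yS i j : xS i * yS j = (i == j)%:R.
Proof.
by rewrite ratS_y tau_x scale0r rmorph0 mulr0 add0r delta_x rmorph_nat.
Qed.

Lemma skew_e_idem : skew_e * skew_e = skew_e.
Proof. exact: (one_sub_sum_idem xS_yS). Qed.

Definition skewI : {pred skew} := gen_ideal skew_e.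
HB.instance Definition _ := GRing.ZmodClosed.on skewI.

Lemma scoef_x i w : scoef (poly_series (xpoly i)) w = ([:: i] == w)%:R.
Proof. exact: poly_seriesU. Qed.

Lemma scoef_mulx f i v j : scoef (f * poly_series (xpoly i)) (rcons v j) =
  (i == j)%:R * scoef f v.
Proof.
have szw : size (rcons v j) = (size v).+1 by rewrite size_rcons.
have d1 : drop (size v) (rcons v j) = [:: j] by rewrite drop_rcons // drop_size.
have d2 : drop (size v).+1 (rcons v j) = [::] by rewrite drop_oversize ?szw.
have t1 : take (size v) (rcons v j) = v by rewrite -cats1 take_size_cat.
rewrite scoefM szw 2!big_ord_recr !scoef_x d1 d2 t1 /= mulr0 addr0.
rewrite eqseq_cons andbT big1 ?add0r 1?mulrC // => l _; rewrite mcoeffU -val_eqE.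
rewrite /= drop_rcons; last exact: ltnW.
case: eqP => [/(congr1 size)|]; last by rewrite mulr0.
by rewrite size_rcons size_drop /=; have := ltn_ord l; lia.
Qed.

Lemma series_decomp f :
  f = (scoef f [::])%:A + \sum_i transduction i f * poly_series (xpoly i).
Proof.
apply/ncseriesP=> w.
have scoef_sum (F : I -> ncseries) : scoef (\sum_i F i) w = \sum_i scoef (F i) w.
  by elim/big_rec2: _ => // i f1 f2 _ <-.
rewrite scoefD scoef_sum scoefZ scoef1.
case/lastP: w {scoef_sum} => [|v j].
  rewrite mulr1 big1 ?addr0 // => i _; by rewrite scoefM_nil scoef_x mulr0.
under eq_bigr do rewrite scoef_mulx.
rewrite (bigD1 j) //= eqxx mul1r big1 => [|i /negPf ->]; last by rewrite mul0r.
by case: v => [|? ?]; rewrite /= mulr0 add0r addr0.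
Qed.

(** Mathcomp algebras are nonzero, so that [I] has to be shown proper.  For
    every [s] in [I] the endomorphism [r |-> ract s r] of k_rat<X> has finite
    rank; its kernel contains that of a linear map to some [k^m]. *)
Section Proper.

Let ract (s : skew) (r : ratser) : ratser := (ratS r * s)@_[::].

Let coef_ymul i u (r : ratser) v c : (ymul (i :: u) r v c)@_[::] = 0.
Proof.
by elim: v r => [|j v IHv] r /=; rewrite ?mcoeffD ?IHv mcoeffU ?addr0.
Qed.

Let coef_mul (s t : skew) : (s * t)@_[::] = (ratS s@_[::] * t)@_[::].
Proof.
elim/skew_ind: s => [|s s' Hs Hs'|u r]; first by rewrite mcoeff0 raddf0.
  by rewrite mulrDl !mcoeffD raddfD mulrDl mcoeffD Hs Hs'.
case: u => [|i u]; first by rewrite mcoeffU.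
rewrite mcoeffU /= raddf0 mul0r.
elim/skew_ind: t => [|t t' Ht Ht'|v c]; first by rewrite mulr0.
  by rewrite mulrDr !mcoeffD Ht Ht' mcoeff0 addr0.
rewrite [_ * _]skew_mulUU coef_ymul. by rewrite mcoeff0.
Qed.

Let ractM s t r : ract (s * t) r = ract t (ract s r).
Proof. by rewrite /ract mulrA coef_mul. Qed.

Let ract_linear s a r r' :
  ract s (a *: r + r') = a *: ract s r + ract s r'.
Proof.
rewrite /ract; have -> : ratS (a *: r + r') = a *: ratS r + ratS r'.
  by rewrite /ratS smonoD smonoZ.
by rewrite mulrDl -[_ * s]skew_scaleAl mcoeffD coef_scale.
Qed.

Let ractD s t r : ract (s + t) r = ract s r + ract t r.
Proof. by rewrite /ract mulrDr mcoeffD. Qed.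

Let ractN s r : ract (- s) r = - ract s r.
Proof. by rewrite /ract mulrN mcoeffN. Qed.

Let ract1 r : ract 1 r = r.
Proof. by rewrite /ract mulr1 mcoeffU. Qed.

Let finite_rank : {pred skew} := fun s => `[< exists m (phi : ratser -> 'rV[k]_m),
  (forall a r r', phi (a *: r + r') = a *: phi r + phi r') /\
  forall r, phi r = 0 -> ract s r = 0 >].

Let ract0 s : ract s 0 = 0.
Proof. by rewrite /ract raddf0 mul0r mcoeff0. Qed.

Let finite_rank_ideal : two_sided_ideal finite_rank.
Proof.
split; [split|].
- apply/asboolP; exists 0, (fun=> 0); split=> [a r r'|r _].
    by rewrite scaler0 addr0.
  by rewrite /ract mulr0 mcoeff0.
- move=> s t /asboolP[m1 [phi1 [L1 H1]]] /asboolP[m2 [phi2 [L2 H2]]].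
  apply/asboolP; exists (m1 + m2)%N, (fun r => row_mx (phi1 r) (phi2 r)).
  split=> [a r r'|r]; first by rewrite L1 L2 scale_row_mx add_row_mx.
  rewrite -row_mx0 => /eq_row_mx[/H1 s0 /H2 t0].
  by rewrite ractD ractN s0 t0 subr0.
- move=> a s /asboolP[m [phi [L H]]]; split; apply/asboolP.
    exists m, (fun r => phi (ract a r)); split=> [b r r'|r /H].
      by rewrite ract_linear L.
    by rewrite ractM.
  exists m, phi; split=> // r /H; rewrite ractM => ->; exact: ract0.
Qed.

Let ract_e r : ract skew_e r = (tau r)%:A.
Proof.
have ractyx i : ract (yS i * xS i) r = delta i r * poly_rat (xpoly i).
  rewrite ractM /ract [ratS r * _]skew_mulUU /= mcoeffD !mcoeffU /= add0r.
  by rewrite mulr1 -rmorphM mcoeffU.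
have ractS (F : I -> skew) : ract (\sum_i F i) r = \sum_i ract (F i) r.
  by rewrite /ract mulr_sumr raddf_sum.
rewrite ractD ractN ract1 ractS; under eq_bigr do rewrite ractyx.
apply/eqP; rewrite subr_eq; apply/eqP/val_inj.
rewrite /= [LHS]series_decomp; congr (_ + _).
by rewrite [RHS](raddf_sum (\val : ratser -> ncseries)).
Qed.

Let X : ratser := poly_rat (xpoly ord0).

Let scoef_X l m : scoef (ratval (X ^+ l)) (nseq m ord0) = (l == m)%:R.
Proof.
elim: l m => [|l IHl] [|m] //.
  by rewrite exprSr [LHS]scoefM_nil [in LHS]scoef_x mulr0.
rewrite exprSr -[in LHS](addn1 m) nseqD cats1 [LHS]scoef_mulx eqxx mul1r IHl.
by rewrite eqSS.
Qed.

Lemma skewI_proper : 1 \notin skewI.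
Proof.
have e_fin : skew_e \in finite_rank.
  apply/asboolP; exists 1%N, (fun r => (tau r)%:M); split=> [a r r'|r].
    by rewrite scale_scalar_mx -raddfD -tauZ -tauD.
  move=> /matrixP/(_ 0 0); rewrite !mxE eqxx mulr1n ract_e => ->.
  by rewrite scale0r.
apply/negP=> /asboolP/(_ _ finite_rank_ideal e_fin)/asboolP[m [phi [L H]]].
pose M := \matrix_(l < m.+1) phi (X ^+ l).
have /rowV0Pn[v /sub_kermxP vM] : kermx M != 0.
  rewrite -mxrank_eq0 mxrank_ker -lt0n subn_gt0 ltnS.
  exact: rank_leq_col.
case/eqP; apply/rowP=> j; rewrite [RHS]mxE.
have phi0 : phi 0 = 0.
  by have := L (-1) 0 0; rewrite scaler0 addr0 scaleN1r addNr.
have phi_sum (F : 'I_m.+1 -> ratser) (a : 'I_m.+1 -> k) :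
    phi (\sum_l a l *: F l) = \sum_l a l *: phi (F l).
  elim/big_rec2: _ => // l y z _ <-; exact: L.
have: \sum_(l < m.+1) v 0 l *: X ^+ l = 0.
  rewrite -[LHS]ract1; apply: H; rewrite phi_sum; apply: etrans vM.
  by rewrite mulmx_sum_row; apply: eq_bigr => l _; rewrite rowK.
move=> /(congr1 (\val : ratser -> ncseries)); rewrite raddf_sum.
move=> /ncseriesP/(_ (nseq j ord0)).
have scoef_sum (F : 'I_m.+1 -> ncseries) w :
    scoef (\sum_l F l) w = \sum_l scoef (F l) w.
  by elim/big_rec2: _ => // l f1 f2 _ <-.
rewrite scoef_sum (bigD1 j) //= scoef_X eqxx mulr1 big1 ?addr0 // => l.
by rewrite scoef_X -val_eqE => /negPf /= ->; rewrite mulr0.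
Qed.

End Proper.

(** [T = S/I]: mathcomp only has the additive quotient and, for commutative
    rings, the ring quotient. *)
Definition algT : Type := ring_quotient.Quotient.quot (skewI : zmodClosed skew).
HB.instance Definition _ := GRing.Zmodule.on algT.

Definition piT (s : skew) : algT :=
  \pi_(ring_quotient.Quotient.quot (skewI : zmodClosed skew)) s.
Definition reprT (x : algT) : skew := repr x.

Lemma reprTK : cancel reprT piT. Proof. exact: reprK. Qed.

Lemma piT_eq s t : (piT s == piT t) = (s - t \in skewI).
Proof. by rewrite ring_quotient.Quotient.idealrBE. Qed.

Lemma piT_surj x : exists s, piT s = x.
Proof. by exists (reprT x); rewrite reprTK. Qed.

Fact piT_zmod : zmod_morphism piT.
Proof. by move=> s t; rewrite /piT raddfB. Qed.
HB.instance Definition _ :=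
  GRing.isZmodMorphism.Build skew algT piT piT_zmod.

Definition T_one : algT := piT 1.
Definition T_mul (x y : algT) : algT := piT (reprT x * reprT y).
Definition T_scale (a : k) (x : algT) : algT := piT (a *: reprT x).

Let skewI_ideal : two_sided_ideal skewI. Proof. exact: gen_idealP. Qed.

Lemma piT_mul s t : T_mul (piT s) (piT t) = piT (s * t).
Proof.
have [_ idl] := skewI_ideal.
have dI u : reprT (piT u) - u \in skewI by rewrite -piT_eq reprTK.
apply/eqP; rewrite piT_eq.
have -> : reprT (piT s) * reprT (piT t) - s * t =
    (reprT (piT s) - s) * reprT (piT t) + s * (reprT (piT t) - t).
  by rewrite mulrBl mulrBr addrA subrK.
by rewrite rpredD //; [case: (idl (reprT (piT t)) _ (dI s))
                      | case: (idl s _ (dI t))].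
Qed.

Lemma piT_scale a s : T_scale a (piT s) = piT (a *: s).
Proof.
have [_ idl] := skewI_ideal.
have dI : reprT (piT s) - s \in skewI by rewrite -piT_eq reprTK.
apply/eqP; rewrite piT_eq -scalerBr -mulr_algl.
by case: (idl a%:A _ dI).
Qed.

Fact T_mulA : associative T_mul.
Proof.
move=> x y z; have [s <-] := piT_surj x; have [t <-] := piT_surj y.
by have [u <-] := piT_surj z; rewrite !piT_mul mulrA.
Qed.
Fact T_mul1 : left_id T_one T_mul.
Proof. by move=> x; have [s <-] := piT_surj x; rewrite piT_mul mul1r. Qed.
Fact T_mulr1 : right_id T_one T_mul.
Proof. by move=> x; have [s <-] := piT_surj x; rewrite piT_mul mulr1. Qed.
Fact T_mulDl : left_distributive T_mul +%R.
Proof.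
move=> x y z; have [s <-] := piT_surj x; have [t <-] := piT_surj y.
by have [u <-] := piT_surj z; rewrite -raddfD !piT_mul mulrDl raddfD.
Qed.
Fact T_mulDr : right_distributive T_mul +%R.
Proof.
move=> x y z; have [s <-] := piT_surj x; have [t <-] := piT_surj y.
by have [u <-] := piT_surj z; rewrite -raddfD !piT_mul mulrDr raddfD.
Qed.
Fact T_one_neq0 : T_one != 0.
Proof. by rewrite -(raddf0 piT) piT_eq subr0 skewI_proper. Qed.

HB.instance Definition _ := GRing.Zmodule_isNzRing.Build algT
  T_mulA T_mul1 T_mulr1 T_mulDl T_mulDr T_one_neq0.

Fact T_scaleA a b x : T_scale a (T_scale b x) = T_scale (a * b) x.
Proof. by have [s <-] := piT_surj x; rewrite !piT_scale scalerA. Qed.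
Fact T_scale1 : left_id 1 T_scale.
Proof. by move=> x; have [s <-] := piT_surj x; rewrite piT_scale scale1r. Qed.
Fact T_scaleDr : right_distributive T_scale +%R.
Proof.
move=> a x y; have [s <-] := piT_surj x; have [t <-] := piT_surj y.
by rewrite -raddfD !piT_scale scalerDr raddfD.
Qed.
Fact T_scaleDl x : {morph T_scale^~ x : a b / a + b}.
Proof.
by move=> a b; have [s <-] := piT_surj x; rewrite !piT_scale scalerDl raddfD.
Qed.

HB.instance Definition _ := GRing.Zmodule_isLmodule.Build k algT
  T_scaleA T_scale1 T_scaleDr T_scaleDl.

Let piTM s t : piT s * piT t = piT (s * t). Proof. exact: piT_mul. Qed.
Let piTZ a s : a *: piT s = piT (a *: s). Proof. exact: piT_scale. Qed.

Fact T_scaleAl a (x y : algT) : a *: (x * y) = (a *: x) * y.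
Proof.
have [s <-] := piT_surj x; have [t <-] := piT_surj y.
by rewrite piTM !piTZ piTM scalerAl.
Qed.
HB.instance Definition _ := GRing.Lmodule_isLalgebra.Build k algT T_scaleAl.

Fact T_scaleAr a (x y : algT) : a *: (x * y) = x * (a *: y).
Proof.
have [s <-] := piT_surj x; have [t <-] := piT_surj y.
by rewrite piTM !piTZ piTM scalerAr.
Qed.
HB.instance Definition _ := GRing.Lalgebra_isAlgebra.Build k algT T_scaleAr.

Fact piT_monoid : monoid_morphism piT.
Proof. by split=> // s t; rewrite piTM. Qed.
HB.instance Definition _ :=
  GRing.isMonoidMorphism.Build skew algT piT piT_monoid.

Fact piT_scalable : scalable piT.
Proof. by move=> a s; rewrite piTZ. Qed.
HB.instance Definition _ :=
  GRing.isScalable.Build k skew algT _ piT piT_scalable.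

Definition poly_T : {lrmorphism ncpoly -> algT} := piT \o ratS \o poly_rat.

Definition xT i : algT := piT (xS i).
Definition yT i : algT := piT (yS i).

Lemma poly_T_x i : poly_T (xpoly i) = xT i.
Proof. by []. Qed.

Inductive Sigma1 : mxset ncpoly :=
| Sigma1_square m (M : 'M[ncpoly]_m) : Sigma' xpoly M -> Sigma1 M
| Sigma1_col : Sigma1 (\col_(i < n.+1) xpoly i).

End Algebras.

Arguments ratS {k n} r.
Arguments xpoly {k n} i.
Arguments nceval {k n V} a p.
Arguments Sigma' {k n V} a m M.
Arguments xT {k n} i.
Arguments yT {k n} i.

Global Opaque ns_mul skew_mul skew_scale.

(* Main.v *)
From HB Require Import structures.
Require Import Defs.
From mathcomp Require Import all_boot all_order all_algebra.
From mathcomp Require Import boolp classical_sets.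
From mathcomp Require Import finmap monalg zify.

Set Implicit Arguments.
Unset Strict Implicit.
Unset Printing Implicit Defensive.

Import GRing.Theory.
Local Open Scope ring_scope.

(** Universality.  A rational series [f] is given by a finite linear system:
    [f = u z] for a column [z] of series with [z = v + sum_i x_i A_i z], where
    [u], [v] and the [A_i] are matrices of scalars ([rational_recognizable]).
    If [g : k<X> -> C] inverts [Sigma_1] and [a_i = g x_i], then
    [1 - sum_i a_i A_i] is invertible over [C], so the same system has a unique
    solution [zeta] over [C], and [f] has to be sent to [u zeta].  This element
    depends on [f] alone.  Indeed, the row vectors [w] over [k] with [w z = 0]
    form a subspace of [k^m] that is stable under every [A_i] and annihilates
    [v]: this is read off from the constant term and the left quotients of
    [w z].  If the rows of [K] span it then [K A_i = N_i K], so [K zeta] solves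
    a homogeneous system, and [K zeta = 0] ([recognizable_zero]).  To say that
    sums and products of series go to sums and products, the systems are
    studied over an arbitrary ring, and applied to [k<<X>> x C]: the pairs
    [(f, c)] given by linear systems are closed under the ring operations, and
    form the graph of the required morphism on k_rat<X> ([rational_extension]).

    The inverse of the column [(a_i)] is a row [(b_j)], and
    [r = tau r + sum_i delta_i(r) x_i] gives
    [r b_j = b_j tau(r) + delta_j(r)] in [C], which is the relation that defines
    [S]; so the morphism extends to [S], kills [e], and descends to [T]
    ([T_extension]).  Conversely, [Sigma'] becomes invertible already over
    k_rat<X>, which is a local ring with residue map [tau]
    ([poly_T_inverts]).

    Heredity.  The projection onto [T] of a trivial extension [T + N] by a
    bimodule [N] has a kernel of square zero, hence a matrix is invertible over
    [T + N] as soon as it is over [T].  Universality then provides a unique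
    derivation [T -> N] with prescribed values on the [x_i]: this is
    [T_free_derivations], the elementary form of the fact that the bimodule of
    differentials of [T] is free on the [d x_i].  For any ring with this
    property the groups [Ext^2] vanish, because [Ext^1(Q, M)] is the quotient of
    the derivations [T -> Hom_k(Q, M)], that is, of the families of elements of
    [Hom_k(Q, M)], by the inner ones, and this is right exact in [M].  The
    proof of [free_derivations_hereditary] unfolds this argument for
    [Q = T / J] into an explicit lifting of maps [J -> N].  The property is
    left-right symmetric. *)

(** * Elements of a ring given by linear systems over a field *)

Section Recognizable.
Context (k : fieldType) (N : nat) (D : pzRingType) (eta : {rmorphism k -> D}).
Context (x : 'I_N -> D).

Local Notation "A ^e" := (map_mx eta A) (at level 2, format "A ^e").

(** The [x i] multiply from the left because the entries of [z] are to be
    recovered from left quotients of series. *)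
Definition affine m (v : 'cV[k]_m) (A : 'I_N -> 'M[k]_m) (z : 'cV[D]_m) :=
  v^e + \sum_i x i *: (A i)^e *m z.

Definition solution m (v : 'cV[k]_m) (A : 'I_N -> 'M[k]_m) (z : 'cV[D]_m) :=
  z = affine v A z.

Definition recognizable (d : D) : Prop :=
  exists m (u : 'rV[k]_m) (v : 'cV[k]_m) (A : 'I_N -> 'M[k]_m) (z : 'cV[D]_m),
    solution v A z /\ d%:M = u^e *m z.

Let map0 p q : (0 : 'M[k]_(p, q))^e = 0. Proof. exact: map_mx0. Qed.
Let mapD p q (A B : 'M[k]_(p, q)) : (A + B)^e = A^e + B^e.
Proof. exact: map_mxD. Qed.
Let mapN p q (A : 'M[k]_(p, q)) : (- A)^e = - A^e. Proof. exact: map_mxN. Qed.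

Lemma solution_col p q (v1 : 'cV[k]_p) (v2 : 'cV[k]_q) A11 A12 A21 A22 z1 z2 :
  z1 = v1^e + \sum_i (x i *: (A11 i)^e *m z1 + x i *: (A12 i)^e *m z2) ->
  z2 = v2^e + \sum_i (x i *: (A21 i)^e *m z1 + x i *: (A22 i)^e *m z2) ->
  solution (col_mx v1 v2)
    (fun i => block_mx (A11 i) (A12 i) (A21 i) (A22 i)) (col_mx z1 z2).
Proof.
move=> z1E z2E; rewrite /solution /affine map_col_mx.
under eq_bigr do rewrite map_block_mx scale_block_mx mul_block_col.
have -> (F : 'I_N -> 'cV[D]_p) (G : 'I_N -> 'cV[D]_q) :
    \sum_i col_mx (F i) (G i) = col_mx (\sum_i F i) (\sum_i G i).
  by elim/big_rec3: _ => [|i y1 y2 y3 _ ->]; rewrite ?col_mx0 ?add_col_mx.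
by rewrite add_col_mx -z1E -z2E.
Qed.

Lemma recognizable_scalar c : recognizable (eta c).
Proof.
exists 1%N, 1%:M, c%:M, (fun=> 0), (eta c)%:M.
split; last by rewrite map_mx1 mul1mx.
rewrite /solution /affine map_scalar_mx big1 ?addr0 // => i _.
by rewrite map0 scaler0 mul0mx.
Qed.

Lemma recognizable_var i : recognizable (x i).
Proof.
(* The states are [x i] and [1]. *)
exists (1 + 1)%N, (row_mx 1%:M 0), (col_mx 0 1%:M).
exists (fun j => block_mx 0 (j == i)%:R%:M 0 0), (col_mx (x i)%:M 1%:M); split.
  apply: solution_col.
    rewrite map0 add0r (bigD1 i) //= big1 => [|j /negPf ne].
      by rewrite scaler0 mul0mx eqxx map_mx1 mulmx1 add0r addr0 scalemx1.
    by rewrite ne scaler0 mul0mx raddf0 map0 scaler0 mul0mx addr0.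
  rewrite map_mx1 big1 ?addr0 // => j _.
  by rewrite map0 scaler0 !mul0mx addr0.
by rewrite map_row_mx map_mx1 map0 mul_row_col mul1mx mul0mx addr0.
Qed.

Lemma recognizableD d d' :
  recognizable d -> recognizable d' -> recognizable (d + d').
Proof.
move=> [m [u [v [A [z [zE dE]]]]]] [m' [u' [v' [A' [z' [zE' dE']]]]]].
exists (m + m')%N, (row_mx u u'), (col_mx v v').
exists (fun i => block_mx (A i) 0 0 (A' i)), (col_mx z z'); split.
  apply: solution_col; [rewrite [LHS]zE|rewrite [LHS]zE']; congr (_ + _);
  by apply: eq_bigr => i _; rewrite map0 scaler0 mul0mx ?addr0 ?add0r.
by rewrite raddfD /= dE dE' map_row_mx mul_row_col.
Qed.

Hypothesis xC : forall i c, x i * eta c = eta c * x i.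

Lemma mul_map_mxZ p q r (B : 'M[k]_(p, q)) i (Z : 'M[D]_(q, r)) :
  B^e *m (x i *: Z) = x i *: (B^e *m Z).
Proof.
apply/matrixP=> a b; rewrite !mxE mulr_sumr; apply: eq_bigr => c _.
by rewrite !mxE mulrA -xC mulrA.
Qed.

(** The states are those of the left factor multiplied by [d'], followed by
    those of [d']: multiplying [z = v + sum_i x_i A_i z] by [d'] turns [v] into
    [v d'], and [d' = u' z'] is unfolded once more. *)
Lemma recognizableM d d' :
  recognizable d -> recognizable d' -> recognizable (d * d').
Proof.
move=> [m [u [v [A [z [zE dE]]]]]] [m' [u' [v' [A' [z' [zE' dE']]]]]].
exists (m + m')%N, (row_mx u 0), (col_mx (v *m u' *m v') v').
exists (fun i => block_mx (A i) (v *m u' *m A' i) 0 (A' i)).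
exists (col_mx (z *m d'%:M) z'); split.
  apply: solution_col.
    rewrite big_split /= [in LHS]zE mulmxDl {1}dE' [in LHS]zE' !mulmxA.
    rewrite mulmxDr !map_mxM -addrA; congr (_ + _); rewrite addrC.
    rewrite mulmx_suml mulmx_sumr; congr (_ + _); apply: eq_bigr => i _.
      by rewrite mulmxA.
    by rewrite !map_mxM -!scalemxAl -mulmxA !mul_map_mxZ !mulmxA.
  rewrite [LHS]zE'; congr (_ + _); apply: eq_bigr => i _.
  by rewrite map0 scaler0 mul0mx add0r.
rewrite map_row_mx map0 mul_row_col mul0mx addr0 mulmxA -dE.
by rewrite scalar_mxM.
Qed.

(** Multiplying [d = u z = u v + sum_i x_i u A_i z] by [h] gives
    [1 = (u v) h + sum_i x_i u A_i (z h)], which expresses [h] through [z h]; so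
    [h] and [z h] are the states of a system for [h]. *)
Lemma recognizable_inv m (u : 'rV[k]_m) (v : 'cV[k]_m) A z d h :
  solution v A z -> d%:M = u^e *m z -> d * h = 1 -> (u *m v) 0 0 != 0 ->
  recognizable h.
Proof.
move=> zE dE dh; set t := (u *m v) 0 0 => t0.
pose B i := - (t^-1 *: (u *m A i)).
have uvE : u *m v = t%:M by rewrite [LHS]mx11_scalar.
have hE : h%:M = (t^-1)%:M^e + \sum_i x i *: (B i)^e *m (z *m h%:M).
  have : (t^-1)%:M^e *m (d * h)%:M = (t^-1)%:M^e :> 'M_1 by rewrite dh mulmx1.
  rewrite scalar_mxM dE {1}zE !(mulmxDr, mulmxDl) !mulmxA -!map_mxM -mulmxA.
  rewrite uvE -scalar_mxM mulVf // map_mx1 mul1mx => /(canRL (addrK _)) hE.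
  rewrite [LHS]hE; congr (_ + _); rewrite mulmx_sumr mulmx_suml -sumrN.
  apply: eq_bigr => i _.
  rewrite /B -[t^-1 *: _]mul_scalar_mx mapN scalerN mulNmx !map_mxM.
  by rewrite -!scalemxAl -!mulmxA -scalemxAl !mul_map_mxZ !mulmxA.
exists (1 + m)%N, (row_mx 1%:M 0), (col_mx (t^-1)%:M (v *m (t^-1)%:M)).
exists (fun i => block_mx 0 (B i) 0 (A i + v *m B i)).
exists (col_mx h%:M (z *m h%:M)); split.
  apply: solution_col.
    rewrite [LHS]hE; congr (_ + _); apply: eq_bigr => i _.
    by rewrite map0 scaler0 mul0mx add0r.
  rewrite {1}zE mulmxDl {1}hE mulmxDr map_mxM -addrA; congr (_ + _).
  rewrite addrC mulmx_suml mulmx_sumr -big_split; apply: eq_bigr => i _ /=.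
  rewrite map0 scaler0 mul0mx add0r mapD map_mxM scalerDr mulmxDl.
  by rewrite -!scalemxAl mul_map_mxZ !mulmxA.
by rewrite map_row_mx map0 map_mx1 mul_row_col mul0mx addr0 mul1mx.
Qed.

End Recognizable.

Section PairMorphism.
Context (A B C : pzRingType) (f : {rmorphism A -> B}) (g : {rmorphism A -> C}).

Definition pair_morph (a : A) : B * C := (f a, g a).

Fact pair_morph_zmod : zmod_morphism pair_morph.
Proof. by move=> a b; rewrite /pair_morph !raddfB. Qed.
HB.instance Definition _ :=
  GRing.isZmodMorphism.Build A (B * C)%type pair_morph pair_morph_zmod.

Fact pair_morph_monoid : monoid_morphism pair_morph.
Proof. by split=> [|a b]; rewrite /pair_morph ?rmorph1 ?rmorphM. Qed.
HB.instance Definition _ :=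
  GRing.isMonoidMorphism.Build A (B * C)%type pair_morph pair_morph_monoid.
End PairMorphism.

Lemma pair_mx_eq (B C : Type) p q (M N : 'M[B * C]_(p, q)) :
  map_mx fst M = map_mx fst N -> map_mx snd M = map_mx snd N -> M = N.
Proof.
move=> /matrixP h1 /matrixP h2; apply/matrixP=> i j.
move: (h1 i j) (h2 i j); rewrite !mxE => e1 e2.
by rewrite [LHS]surjective_pairing e1 e2 -surjective_pairing.
Qed.

Lemma map_affine (k : fieldType) N (D D' : pzRingType)
    (eta : {rmorphism k -> D}) (eta' : {rmorphism k -> D'})
    (x : 'I_N -> D) (x' : 'I_N -> D') (f : {rmorphism D -> D'}) m v A z :
  (forall c, f (eta c) = eta' c) -> (forall i, f (x i) = x' i) ->
  map_mx f (@affine k N D eta x m v A z) = affine eta' x' v A (map_mx f z).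
Proof.
move=> fe fx; apply/matrixP=> a b; rewrite !mxE !summxE rmorphD fe rmorph_sum.
congr (_ + _); apply: eq_bigr => i _.
rewrite !mxE rmorph_sum; apply: eq_bigr => j _.
by rewrite !mxE !rmorphM fe fx.
Qed.

Section MaxKernel.
Context (k : fieldType) (D : pzRingType) (eta : {rmorphism k -> D}).
Local Notation "A ^e" := (map_mx eta A) (at level 2, format "A ^e").

(** A matrix of maximal rank among those that annihilate [z]: its rows span all
    the linear relations over [k] between the entries of [z]. *)
Lemma max_annihilator m (z : 'cV[D]_m) : exists K : 'M[k]_m,
  K^e *m z = 0 /\ forall p (W : 'M[k]_(p, m)), W^e *m z = 0 -> (W <= K)%MS.
Proof.
pose P r := `[< exists K : 'M[k]_m, K^e *m z = 0 /\ \rank K = r >].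
have exP : exists r, P r.
  exists 0%N; apply/asboolP; exists 0; rewrite mxrank0; split=> //.
  apply/matrixP=> a b; rewrite !mxE big1 // => c _.
  by rewrite !mxE rmorph0 mul0r.
have ubP r : P r -> (r <= m)%N.
  by move=> /asboolP[K [_ <-]]; exact: rank_leq_col.
have [r /asboolP[K [Kz rK]] rmax] := ex_maxnP exP ubP.
exists K; split=> // p W Wz; pose K' := (K + W)%MS.
have /submxP[X K'E] : (K' <= col_mx K W)%MS by rewrite addsmxE.
have K'z : K'^e *m z = 0.
  by rewrite K'E map_mxM -mulmxA map_col_mx mul_col_mx Kz Wz col_mx0 mulmx0.
have leK' : (\rank K' <= \rank K)%N.
  by rewrite rK; apply: rmax; apply/asboolP; exists K'.
apply: submx_trans (addsmxSr K W) _.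
by have /geq_leqif := mxrank_leqif_sup (addsmxSl K W); rewrite leK'.
Qed.
End MaxKernel.

(** * Rational series *)

Section Polynomials.
Context (k : fieldType) (n : nat).
Local Notation I := 'I_n.+1.
Local Notation ncpoly := (ncpoly k n).

Lemma ncpoly_monomial c (w : {fmonom I}) :
  << c *g w >> = c *: \prod_(i <- fmonom_val w) xpoly i :> ncpoly.
Proof.
have -> : \prod_(i <- fmonom_val w) xpoly i = << w >> :> ncpoly.
  case: w => w /=; elim: w => [|i w IHw]; last first.
    rewrite big_cons IHw [LHS]fgmulUU mulr1; congr (<< _ *g _ >>).
    by apply/val_inj; rewrite /= fmM.
  rewrite big_nil; congr (<< _ *g _ >>).
  by apply/val_inj; rewrite /= fm1.
by apply/malgP=> u; rewrite mcoeffZ [LHS]mcoeffU [X in _ * X]mcoeffU mulr_natr.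
Qed.

Lemma ncpoly_ind (P : ncpoly -> Prop) : (forall c, P c%:A) ->
  (forall i, P (xpoly i)) -> (forall p q, P p -> P q -> P (p + q)) ->
  (forall p q, P p -> P q -> P (p * q)) -> forall p, P p.
Proof.
move=> PC PX PD PM p; rewrite (monalgE p).
apply: big_ind => // [|w _]; first by have := PC 0; rewrite scale0r.
rewrite ncpoly_monomial -mulr_algl; apply: (PM) => //.
apply: big_ind => [|q r|i _]; [|exact: PM|exact: PX].
by have := PC 1; rewrite scale1r.
Qed.

Lemma ncpoly_morph_eq (C : pzRingType) (f g : {rmorphism ncpoly -> C}) :
  (forall c, f c%:A = g c%:A) -> (forall i, f (xpoly i) = g (xpoly i)) ->
  f =1 g.
Proof.
move=> fgC fgX; apply: ncpoly_ind => // p q pE qE.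
  by rewrite !raddfD /= pE qE.
by rewrite !rmorphM pE qE.
Qed.

End Polynomials.

Section Series.
Context (k : fieldType) (n : nat).
Local Notation I := 'I_n.+1.
Local Notation ncseries := (ncseries k n).
Local Notation etaX := (in_alg ncseries).
Let X (i : I) : ncseries := poly_series (xpoly i).

Definition constant_term (f : ncseries) : k := scoef f [::].
Arguments constant_term : simpl never.

Fact constant_term_zmod : zmod_morphism constant_term.
Proof. by []. Qed.
HB.instance Definition _ :=
  GRing.isZmodMorphism.Build ncseries k constant_term constant_term_zmod.

Fact constant_term_monoid : monoid_morphism constant_term.
Proof. by split=> // f g; exact: scoefM_nil. Qed.
HB.instance Definition _ :=
  GRing.isMonoidMorphism.Build ncseries k constant_term constant_term_monoid.

Lemma constant_termC c : constant_term c%:A = c.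
Proof. exact: mulr1. Qed.

Lemma constant_termX i : constant_term (X i) = 0.
Proof. by rewrite /constant_term scoef_x. Qed.

Lemma scoef_sum (T : finType) (F : T -> ncseries) w :
  scoef (\sum_i F i) w = \sum_i scoef (F i) w.
Proof. by elim/big_rec2: _ => // i f1 f2 _ <-. Qed.

Lemma scoef_mulX i f j w : scoef (X i * f) (j :: w) = (i == j)%:R * scoef f w.
Proof.
rewrite [LHS]ns_mul_cons [scoef (X i) _]constant_termX mul0r add0r.
have -> : lquot j (X i) = (i == j)%:R *: 1.
  apply/ncseriesP=> -[|l v]; rewrite /= mcoeffU -val_eqE /= eqseq_cons.
    by rewrite andbT mulr1.
  by rewrite andbF mulr0.
by rewrite -[LHS]/(scoef (_%:A * f) w) -scalerAl mul1r.
Qed.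

(** [c] is the constant term, and [s i] the left quotient by [x_i], of
    [c + sum_i x_i s_i]. *)
Lemma series_split c (s : I -> ncseries) :
  etaX c + \sum_i X i * s i = 0 -> c = 0 /\ forall i, s i = 0.
Proof.
move=> e; split=> [|i].
  have := congr1 constant_term e; rewrite rmorphD rmorph_sum rmorph0 /=.
  rewrite constant_termC big1 ?addr0 // => i _.
  by rewrite rmorphM /= constant_termX mul0r.
apply/ncseriesP=> w; have /ncseriesP/(_ (i :: w)) := e.
rewrite scoefD scoef_sum (bigD1 i) //= big1 => [|j /negPf ji]; last first.
  by rewrite [LHS]scoef_mulX ji mul0r.
by rewrite [scoef _ _ + 0]addr0 mulr0 add0r [LHS]scoef_mulX eqxx mul1r => ->.
Qed.

Lemma etaX_comm i c : X i * etaX c = etaX c * X i.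
Proof. by rewrite mulr_algl mulr_algr. Qed.

(** Half of the Kleene-Schuetzenberger theorem: the series given by linear
    systems form a division closed subalgebra. *)
Lemma rational_recognizable f : f \in @rational k n -> recognizable etaX X f.
Proof.
move=> /asboolP/(_ (fun f => `[< recognizable etaX X f >])) h.
apply/asboolP/h => {h}.
- split=> [|c g h /asboolP gr /asboolP hr|g h /asboolP gr /asboolP hr].
  + by apply/asboolP; rewrite -(rmorph1 etaX); exact: recognizable_scalar.
  + apply/asboolP; rewrite -mulr_algl; apply: recognizableD => //.
    by apply: recognizableM etaX_comm _ _ _ gr; exact: recognizable_scalar.
  + by apply/asboolP; exact: recognizableM etaX_comm _ _ gr hr.
- move=> p; apply/asboolP; elim/ncpoly_ind: p => [c|i|p q pr qr|p q pr qr].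
  + by rewrite linearZ /= rmorph1; exact: recognizable_scalar.
  + exact: recognizable_var.
  + by rewrite raddfD; exact: recognizableD.
  + by rewrite rmorphM; exact: recognizableM etaX_comm _ _ pr qr.
- move=> g h /asboolP[m [u [v [A [z [zE gE]]]]]] gh hg; apply/asboolP.
  apply: (recognizable_inv etaX_comm zE gE gh).
  (* Constant terms turn the system into [z = v], so that [u v] is the constant
     term of [g], which is invertible. *)
  have zv : map_mx constant_term z = v.
    apply/matrixP=> a b; rewrite !mxE [in LHS]zE !mxE rmorphD summxE rmorph_sum.
    rewrite /= constant_termC big1 ?addr0 // => i _; rewrite !mxE rmorph_sum.
    by rewrite big1 // => j _; rewrite !mxE !rmorphM /= constant_termX !mul0r.
  have uz : (u *m v) 0 0 = constant_term g.
    have /matrixP/(_ 0 0)/(congr1 constant_term) := gE.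
    rewrite !mxE mulr1n => ->.
    rewrite rmorph_sum; apply: eq_bigr => j _.
    by rewrite -zv !mxE rmorphM /= constant_termC.
  rewrite uz; apply: contra_eq_neq (congr1 constant_term gh) => g0.
  by rewrite rmorphM /= g0 mul0r rmorph1 eq_sym oner_eq0.
Qed.

End Series.
Arguments constant_term {k n} f : simpl never.

(** * Extending a morphism from polynomials to rational series *)

Lemma rmorphism_of (A B : pzRingType) (f : A -> B) :
  zmod_morphism f -> monoid_morphism f ->
  exists h : {rmorphism A -> B}, h = f :> (A -> B).
Proof.
move=> fB fM; pose addf := GRing.isZmodMorphism.Build A B f fB.
pose mulf := GRing.isMonoidMorphism.Build A B f fM.
by exists (HB.pack_for {rmorphism A -> B} f addf mulf).
Qed.

(** The free algebra: scalars and letters may be sent to arbitrary elements,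
    provided that they commute. *)
Lemma free_eval (k : fieldType) (n : nat) (S : nzRingType)
    (eta : {rmorphism k -> S}) (a : 'I_n.+1 -> S) :
  (forall i c, a i * eta c = eta c * a i) ->
  exists h : {rmorphism ncpoly k n -> S},
  [/\ forall c, h c%:A = eta c, forall i, h (xpoly i) = a i
    & h =1 mmap eta (fun w : {fmonom 'I_n.+1} => \prod_(i <- w) a i)].
Proof.
move=> aC; pose word_eval (w : {fmonom 'I_n.+1}) : S := \prod_(i <- w) a i.
have wordM : mmorphism word_eval.
  split=> [u v|]; rewrite /word_eval; last by rewrite fm1 big_nil.
  by rewrite fmM big_cat.
pose h : {mmorphism {fmonom 'I_n.+1} -> S} :=
  HB.pack_for {mmorphism {fmonom 'I_n.+1} -> S} word_eval
    (isMultiplicative.Build {fmonom 'I_n.+1} S word_eval wordM).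
have [] : multiplicative (mmap eta h).
  apply: commr_mmap_is_multiplicative => p u v.
  rewrite /GRing.comm /= /word_eval; elim/big_ind: _ => //.
  - by rewrite mulr1 mul1r.
  - by move=> s t sC tC; rewrite mulrA sC -mulrA tC mulrA.
move=> hM h1.
have [f fE] := @rmorphism_of (ncpoly k n) S (mmap eta h)
  (@mmap_is_additive _ _ _ eta h) (conj h1 hM).
exists f; rewrite fE; split=> // [c|i]; last first.
  by rewrite mmapU /= rmorph1 mul1r /word_eval big_seq1.
by rewrite mmapZ mmap1 mulr1.
Qed.

Section RationalExtension.
Context (k : fieldType) (n : nat).
Local Notation I := 'I_n.+1.
Local Notation ncpoly := (ncpoly k n).
Local Notation ncseries := (ncseries k n).
Local Notation ratser := (ratser k n).

Lemma nceval_xpoly (p : ncpoly) : nceval xpoly p = p.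
Proof.
have [|h [hC hX hE]] := @free_eval k n ncpoly (in_alg ncpoly) xpoly.
  by move=> i c; rewrite mulr_algl mulr_algr.
rewrite -[LHS]hE; apply: (@ncpoly_morph_eq k n ncpoly h idfun) => [c|i].
  by rewrite hC.
by rewrite hX.
Qed.

Lemma pencil_Sigma1 m (A : I -> 'M[k]_m) :
  Sigma1 (1%:M - \sum_i xpoly i *: map_mx (in_alg ncpoly) (A i)).
Proof.
apply: Sigma1_square; exists 1%:M.
exists (- \sum_i xpoly i *: map_mx (in_alg ncpoly) (A i)).
split; first exact: unitmx1; last first.
  rewrite map_mx1; congr (_ + _).
  by apply/matrixP=> a b; rewrite !mxE nceval_xpoly.
move=> r c.
pose h : {rmorphism ncpoly -> k} := constant_term \o @poly_series k n.
rewrite -[LHS]/(h _) mxE summxE rmorphN rmorph_sum big1 ?oppr0 // => i _.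
by rewrite mxE rmorphM [h (xpoly i)]constant_termX mul0r.
Qed.

Lemma inverts_pencil (C : pzRingType) (g : {rmorphism ncpoly -> C}) :
  inverts g (@Sigma1 k n) -> forall m (A : I -> 'M[k]_m),
  invertible_mx
    (1%:M - \sum_i g (xpoly i) *: map_mx (g \o in_alg ncpoly) (A i)).
Proof.
move=> gS m A; have := gS _ _ _ (pencil_Sigma1 A).
rewrite map_mxB map_mx1 raddf_sum; congr (invertible_mx (_ - _)).
apply: eq_bigr => i _.
apply/matrixP=> p q; rewrite !mxE; exact: rmorphM.
Qed.

Context (C : pzRingType) (eta : {rmorphism k -> C}) (a : I -> C).
Hypothesis aC : forall i c, a i * eta c = eta c * a i.
Hypothesis pencil_invertible : forall m (A : I -> 'M[k]_m),
  invertible_mx (1%:M - \sum_i a i *: map_mx eta (A i)).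

Let etaX : {rmorphism k -> ncseries} := in_alg ncseries.
Let X (i : I) : ncseries := poly_series (xpoly i).
Let D : pzRingType := (ncseries * C)%type.
Let etaD : {rmorphism k -> D} := pair_morph etaX eta.
Let xD i : D := (X i, a i).

Let xDC i c : xD i * etaD c = etaD c * xD i.
Proof.
by congr (_, _); [exact: etaX_comm | exact: aC].
Qed.

Lemma solution_unique0 m (A : I -> 'M[k]_m) (z : 'cV[C]_m) :
  z = \sum_i a i *: map_mx eta (A i) *m z -> z = 0.
Proof.
move=> zE; have [N [_ NP]] := pencil_invertible A.
rewrite -[z]mul1mx -NP -mulmxA mulmxBl mul1mx mulmx_suml -zE subrr.
exact: mulmx0.
Qed.

(** The invertible matrix [1 - sum_i a_i A_i] solves over [C] the system that
    defines [f]. *)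
Lemma recognizable_lift f :
  recognizable etaX X f -> exists c, recognizable etaD xD (f, c).
Proof.
move=> [m [u [v [A [z [zE fE]]]]]]; have [N [PN _]] := pencil_invertible A.
pose y := N *m map_mx eta v.
have yE : solution eta a v A y.
  apply/eqP; rewrite /affine -mulmx_suml -subr_eq -[X in X - _]mul1mx.
  by rewrite -mulmxBl /y mulmxA PN mul1mx.
pose zy : 'cV[D]_m := \matrix_(i, j) (z i j, y i j).
have zyX : map_mx fst zy = z by apply/matrixP=> p q; rewrite !mxE.
have zyC : map_mx snd zy = y by apply/matrixP=> p q; rewrite !mxE.
exists ((map_mx eta u *m y) 0 0), m, u, v, A, zy; split.
  apply: pair_mx_eq.
    by rewrite (map_affine (eta' := etaX) (x' := X)) // zyX.
  by rewrite (map_affine (eta' := eta) (x' := a)) // zyC.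
apply: pair_mx_eq; apply/matrixP=> p q; rewrite !ord1.
  have /matrixP/(_ 0 0) := fE; rewrite !mxE mulr1n /= => ->.
  by rewrite raddf_sum; apply: eq_bigr => j _; rewrite !mxE.
rewrite !mxE mulr1n raddf_sum; apply: eq_bigr => j _.
by rewrite !mxE.
Qed.

(** The relations over [k] between the states [zX] of a system for [0] form a
    subspace stable under the [A i].  Hence they hold between the states [zC]
    over [C] as well, and the linear form [u] is one of them. *)
Lemma recognizable_zero c : recognizable etaD xD (0, c) -> c = 0.
Proof.
move=> [m [u [v [A [z [zE cE]]]]]].
pose zX := map_mx fst z; pose zC := map_mx snd z.
have zXE : solution etaX X v A zX.
  by rewrite /solution /zX {1}zE (map_affine (eta' := etaX) (x' := X)).
have zCE : solution eta a v A zC.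
  by rewrite /solution /zC {1}zE (map_affine (eta' := eta) (x' := a)).
have [K [Kz Kmax]] := max_annihilator etaX zX.
have annih p (W : 'M[k]_(p, m)) : map_mx etaX W *m zX = 0 ->
    W *m v = 0 /\ forall i, map_mx etaX (W *m A i) *m zX = 0.
  rewrite {1}zXE /affine mulmxDr mulmx_sumr => /matrixP Wz.
  have Wz' r : (W *m v) r 0 = 0 /\
      forall i, (map_mx etaX (W *m A i) *m zX) r 0 = 0.
    apply: series_split; have := Wz r 0; rewrite [RHS]mxE; apply: etrans.
    rewrite -map_mxM [RHS]mxE [X in _ = X + _]mxE summxE; congr (_ + _).
    apply: eq_bigr => i _.
    rewrite -scalemxAl mul_map_mxZ; last exact: etaX_comm.
    by rewrite [RHS]mxE map_mxM mulmxA.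
  by split=> [|i]; apply/matrixP=> r s; rewrite ord1 [RHS]mxE; case: (Wz' r).
have [Kv KA] := annih _ _ Kz.
(* [K zC] solves the homogeneous system with the matrices [N_i] such that
   [K A_i = N_i K]. *)
have KC : map_mx eta K *m zC = 0.
  apply: (@solution_unique0 _ (fun i => K *m A i *m pinvmx K)).
  rewrite {1}zCE /affine mulmxDr -map_mxM Kv map_mx0 add0r mulmx_sumr.
  apply: eq_bigr => i _; rewrite -!scalemxAl mul_map_mxZ; last exact: aC.
  congr (_ *: _); rewrite mulmxA [RHS]mulmxA -!map_mxM mulmxKpV //.
  exact: Kmax (KA i).
have uzX : map_mx etaX u *m zX = 0.
  apply/matrixP=> p q; rewrite !ord1.
  have /matrixP/(_ 0 0)/(congr1 fst) := cE; rewrite !mxE mulr1n => /esym.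
  apply: etrans.
  rewrite raddf_sum; apply: eq_bigr => j _.
  by rewrite !mxE.
have /submxP[U uE] := Kmax _ _ uzX.
have <- : (map_mx eta u *m zC) 0 0 = c.
  have /matrixP/(_ 0 0)/(congr1 snd) := cE; rewrite !mxE mulr1n => /esym.
  apply: etrans; rewrite raddf_sum; apply: eq_bigr => j _.
  by rewrite !mxE.
by rewrite uE map_mxM -mulmxA KC mulmx0 mxE.
Qed.

Lemma recognizable_pair_eq f c c' :
  recognizable etaD xD (f, c) -> recognizable etaD xD (f, c') -> c = c'.
Proof.
move=> fc fc'; apply/eqP; rewrite -subr_eq0; apply/eqP/recognizable_zero.
have -> : (0, c - c') = (f, c) + etaD (-1) * (f, c') :> D.
  by congr (_, _); rewrite !rmorphN !rmorph1 mulN1r // subrr.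
apply: recognizableD fc _; apply: recognizableM xDC _ _ _ fc'.
exact: recognizable_scalar.
Qed.

Lemma rational_extension : exists phi : {rmorphism ratser -> C},
  (forall c, phi c%:A = eta c) /\ (forall i, phi (poly_rat (xpoly i)) = a i).
Proof.
have lift r := recognizable_lift (rational_recognizable (ratvalP r)).
pose phi r := projT1 (cid (lift r)).
have phiP r : recognizable etaD xD (ratval r, phi r) := projT2 (cid (lift r)).
have phi_eq r c : recognizable etaD xD (ratval r, c) -> phi r = c.
  exact: recognizable_pair_eq.
have phiC c : phi c%:A = eta c.
  exact/phi_eq/(@recognizable_scalar k _ D etaD xD).
have phiB : zmod_morphism phi.
  move=> r s; apply: phi_eq.
  have -> : (ratval (r - s), phi r - phi s)
      = (ratval r, phi r) + etaD (-1) * (ratval s, phi s) :> D.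
    by congr (_, _); rewrite !rmorphN !rmorph1 mulN1r.
  apply: recognizableD => //; apply: recognizableM xDC _ _ _ _ => //.
  exact: recognizable_scalar.
have phiM : monoid_morphism phi.
  split=> [|r s]; first by rewrite -(rmorph1 eta) -phiC scale1r.
  apply: phi_eq.
  exact: (recognizableM xDC (phiP r) (phiP s)).
have [h hE] := rmorphism_of phiB phiM.
exists h; rewrite hE; split=> // i; apply: phi_eq.
exact: (@recognizable_var k _ D etaD xD).
Qed.

End RationalExtension.

(** * The universal property of [T] *)

Section Quotient.
Context (k : fieldType) (n : nat).
Local Notation I := 'I_n.+1.
Local Notation ncpoly := (ncpoly k n).
Local Notation ncseries := (ncseries k n).
Local Notation ratser := (ratser k n).
Local Notation skew := (Defs.skew k n).
Local Notation algT := (algT k n).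
Local Notation xR i := (poly_rat (@xpoly k n i)).

Lemma ratser_decomp (r : ratser) :
  r = (tau r)%:A + \sum_i delta i r * xR i.
Proof.
apply/val_inj; rewrite /= [LHS]series_decomp; congr (_ + _).
by rewrite [RHS](raddf_sum (\val : ratser -> ncseries)).
Qed.

(** The series on which two morphisms agree form a division closed subalgebra,
    as inverses are unique. *)
Lemma ratser_morph_eq (C : pzRingType) (f g : {rmorphism ratser -> C}) :
  (forall p, f (poly_rat p) = g (poly_rat p)) -> f =1 g.
Proof.
move=> fg r.
have fgC c : f c%:A = g c%:A.
  have <- : poly_rat c%:A = c%:A :> ratser by rewrite linearZ /= rmorph1.
  exact: fg.
pose P : {pred ncseries} := fun s => `[< exists2 r, ratval r = s & f r = g r >].
suff /asboolP[r' /val_inj <-] : ratval r \in P by [].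
have /asboolP := ratvalP r; apply=> [|p|s t].
- split=> [|c s t|s t].
  + by apply/asboolP; exists 1; rewrite ?rmorph1.
  + move=> /asboolP[r1 <- e1] /asboolP[r2 <- e2]; apply/asboolP.
    exists (c *: r1 + r2) => //.
    by rewrite -mulr_algl !rmorphD !rmorphM fgC e1 e2.
  + move=> /asboolP[r1 <- e1] /asboolP[r2 <- e2]; apply/asboolP.
    by exists (r1 * r2) => //; rewrite !rmorphM e1 e2.
- by apply/asboolP; exists (poly_rat p).
- move=> /asboolP[r1 <- e1] st ts; apply/asboolP.
  exists (RatSer (rational_div (ratvalP r1) st ts)) => //.
  set r2 := RatSer _.
  have r12 : r1 * r2 = 1 by exact/val_inj.
  have r21 : r2 * r1 = 1 by exact/val_inj.
  rewrite -[LHS]mulr1 -(rmorph1 g) -r12 rmorphM mulrA -e1 -rmorphM r21.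
  by rewrite rmorph1 mul1r.
Qed.

Section SkewExtension.
Context (C : pzRingType) (phi : {rmorphism ratser -> C}) (b : I -> C).
Hypothesis xb : forall i j, phi (xR i) * b j = (i == j)%:R.
Hypothesis bx : \sum_i b i * phi (xR i) = 1.

Let phi_comm c r : phi c%:A * phi r = phi r * phi c%:A.
Proof. by rewrite -!rmorphM mulr_algl mulr_algr. Qed.

(** The defining relation of [S] holds in [C]: multiply [ratser_decomp] by
    [b j]. *)
Let phi_b r j : phi r * b j = phi (tau r)%:A * b j + phi (delta j r).
Proof.
rewrite {1}(ratser_decomp r) rmorphD rmorph_sum mulrDl mulr_suml.
rewrite (bigD1 j) //= big1 => [|i /negPf ij].
  by rewrite rmorphM -mulrA xb eqxx mulr1 addr0.
by rewrite rmorphM -mulrA xb ij mulr0.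
Qed.

(** [b] commutes with scalars because it is inverse to a column that does. *)
Let b_comm c j : phi c%:A * b j = b j * phi c%:A.
Proof.
rewrite -[LHS]mul1r -bx mulr_suml (bigD1 j) //= big1 ?addr0 => [|i /negPf ij].
  by rewrite !mulrA -(mulrA _ _ (phi _)) -phi_comm -!mulrA xb eqxx mulr1.
by rewrite -mulrA (mulrA (phi _)) -phi_comm -!mulrA xb ij !mulr0.
Qed.

Let psi_mono (w : seq I) (r : ratser) : C := (\prod_(i <- w) b i) * phi r.
Let psi (s : skew) : C := lext psi_mono s.

Let psi_monoD w : {morph psi_mono w : r r' / r + r'}.
Proof. by move=> r r'; rewrite /psi_mono rmorphD mulrDr. Qed.

Let psiD s t : psi (s + t) = psi s + psi t.
Proof. exact: (lextD psi_monoD). Qed.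

Let psiU w r : psi (smono w r) = psi_mono w r.
Proof. exact: (lextU psi_monoD). Qed.

Let psi0 : psi 0 = 0.
Proof. by apply: (addrI (psi 0)); rewrite -psiD !addr0. Qed.

Let psi_ymul u r v c :
  psi (ymul u r v c) = psi_mono u r * psi_mono v c.
Proof.
elim: v r => [|i v IHv] r /=.
  by rewrite psiU /psi_mono big_nil mul1r rmorphM mulrA.
have tau_comm : phi (tau r)%:A * (\prod_(j <- v) b j) =
    (\prod_(j <- v) b j) * phi (tau r)%:A.
  elim/big_ind: _ => [|x y xC yC|j _]; first by rewrite mul1r mulr1.
    by rewrite mulrA xC -mulrA yC mulrA.
  exact: b_comm.
rewrite psiD psiU IHv /psi_mono big_cat !big_cons -[tau r *: c]mulr_algl.
rewrite /= rmorphM -!mulrA -mulrDr (mulrA _ (phi (tau r)%:A)) -tau_comm.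
by rewrite (mulrA (phi r)) phi_b b_comm mulrDl -!mulrA.
Qed.

Lemma skew_extension : exists h : {rmorphism skew -> C},
  (forall r, h (ratS r) = phi r) /\ (forall i, h (yS k i) = b i).
Proof.
have psiB : zmod_morphism psi.
  move=> s t; apply/eqP; rewrite eq_sym subr_eq -psiD subrK.
  exact: eqxx.
have psiM : monoid_morphism psi.
  split; first by rewrite [LHS]psiU /psi_mono big_nil mul1r rmorph1.
  elim/skew_ind=> [|s s' Hs Hs'|u r] t; first by rewrite mul0r psi0 mul0r.
    by rewrite mulrDl !psiD Hs Hs' mulrDl.
  elim/skew_ind: t => [|t t' Ht Ht'|v c]; first by rewrite mulr0 psi0 mulr0.
    by rewrite mulrDr !psiD Ht Ht' mulrDr.
  by rewrite !psiU -psi_ymul -[in RHS]skew_mulUU.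
have [h hE] := rmorphism_of psiB psiM.
exists h; rewrite hE; split=> [r|i].
  by rewrite [LHS]psiU /psi_mono big_nil mul1r.
by rewrite [LHS]psiU /psi_mono big_seq1 rmorph1 mulr1.
Qed.
End SkewExtension.

Lemma T_descent (C : pzRingType) (psi : {rmorphism skew -> C}) :
  psi (skew_e k n) = 0 ->
  exists h : {rmorphism algT -> C}, forall s, h (piT s) = psi s.
Proof.
move=> psie.
have ker s : s \in @skewI k n -> psi s = 0.
  pose J : {pred skew} := fun s => psi s == 0.
  have JE t : (t \in J) = (psi t == 0) by [].
  move=> /asboolP/(_ J) sJ; apply/eqP; rewrite -JE.
  apply: sJ; last by rewrite JE psie.
  split; [split=> [|s1 s2]|move=> c s' ]; rewrite !JE ?rmorph0 //.
    by move=> /eqP h1 /eqP h2; rewrite rmorphB h1 h2 subrr.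
  by move=> /eqP s0; rewrite !rmorphM s0 mulr0 mul0r eqxx.
pose h (x : algT) := psi (reprT x).
have hE s : h (piT s) = psi s.
  apply/eqP; rewrite -subr_eq0 -rmorphB; apply/eqP/ker.
  by rewrite -piT_eq reprTK.
have hB : zmod_morphism h.
  move=> x y; have [s <-] := piT_surj x; have [t <-] := piT_surj y.
  by rewrite -raddfB !hE rmorphB.
have hM : monoid_morphism h.
  split=> [|x y]; first by rewrite -(rmorph1 (@piT k n)) hE rmorph1.
  have [s <-] := piT_surj x; have [t <-] := piT_surj y.
  by rewrite -rmorphM !hE rmorphM.
by have [f fE] := rmorphism_of hB hM; exists f; rewrite fE.
Qed.

Lemma xT_yT i j : @xT k n i * yT j = (i == j)%:R.
Proof. by rewrite /xT /yT -rmorphM xS_yS rmorph_nat. Qed.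

Lemma sum_yT_xT : \sum_i yT i * @xT k n i = 1.
Proof.
apply/eqP; rewrite -(rmorph1 (@piT k n)) eq_sym /yT /xT.
under eq_bigr do rewrite -rmorphM.
by rewrite -rmorph_sum /= piT_eq mem_gen_ideal.
Qed.

Lemma T_extension (C : pzRingType) (g : {rmorphism ncpoly -> C}) :
  inverts g (@Sigma1 k n) ->
  exists h : {rmorphism algT -> C}, forall p, h (poly_T k n p) = g p.
Proof.
move=> gS; pose eta : {rmorphism k -> C} := g \o in_alg ncpoly.
have aC i c : g (xpoly i) * eta c = eta c * g (xpoly i).
  by rewrite /eta /= -!rmorphM mulr_algr mulr_algl.
have [phi [phiC phiX]] := rational_extension aC (inverts_pencil gS).
have phiE p : phi (poly_rat p) = g p.
  apply: (@ncpoly_morph_eq _ _ C (phi \o poly_rat (n:=n)) g) p => [c|i] /=.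
    by rewrite linearZ /= rmorph1 phiC.
  exact: phiX.
have [B [xB Bx]] := gS _ _ _ (@Sigma1_col k n); pose b i := B 0 i.
have xb i j : phi (xR i) * b j = (i == j)%:R.
  rewrite phiX; have /matrixP/(_ i j) := xB.
  by rewrite !mxE big_ord_recl big_ord0 addr0 !mxE.
have bx : \sum_i b i * phi (xR i) = 1.
  have /matrixP/(_ 0 0) := Bx; rewrite !mxE eqxx; apply: etrans.
  by apply: eq_bigr => i _; rewrite !mxE phiX.
have [psi [psiR psiY]] := skew_extension xb bx.
have [|h hE] := @T_descent C psi.
  rewrite rmorphB rmorph1 rmorph_sum -bx; apply/eqP; rewrite subr_eq0.
  apply/eqP.
  apply: eq_bigr => i _; rewrite rmorphM; congr (_ * _).
    exact: esym (psiY i).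
  exact: esym (psiR _).
by exists h => p; rewrite hE psiR phiE.
Qed.

Lemma dual_family_unique (C : pzRingType) m (a b b' : 'I_m -> C) :
  (forall i j, a i * b j = (i == j)%:R) -> \sum_i b' i * a i = 1 -> b =1 b'.
Proof.
move=> ab b'a j; rewrite -[LHS]mul1r -b'a mulr_suml (bigD1 j) //= big1.
  by rewrite -mulrA ab eqxx mulr1 addr0.
by move=> i /negPf ij; rewrite -mulrA ab ij mulr0.
Qed.

(** The images of the [y_j] are determined as the entries of the inverse of the
    column of the [x_i]. *)
Lemma T_morph_eq (C : pzRingType) (h h' : {rmorphism algT -> C}) :
  (forall p, h (poly_T k n p) = h' (poly_T k n p)) -> h =1 h'.
Proof.
move=> hh' t; have [s <-] := piT_surj t.
have hR r : h (piT (ratS r)) = h' (piT (ratS r)).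
  exact: (@ratser_morph_eq C (h \o piT (n:=n) \o ratS)
                             (h' \o piT (n:=n) \o ratS)).
have hX i : h (xT i) = h' (xT i) by rewrite -!poly_T_x hh'.
have hY j : h (yT j) = h' (yT j).
  apply: (@dual_family_unique C _ (fun i => h (xT i)) (fun i => h (yT i))
            (fun i => h' (yT i))) => [i l|].
    by rewrite -rmorphM xT_yT rmorph_nat.
  under eq_bigr do rewrite hX -rmorphM.
  by rewrite -rmorph_sum sum_yT_xT rmorph1.
rewrite (skewE s) !rmorph_sum; apply: eq_bigr => w _ /=.
rewrite !rmorphM /= hR; congr (_ * _); rewrite !rmorph_prod.
by apply: eq_bigr => i _; exact: hY.
Qed.

End Quotient.

(** * The matrices in [Sigma_1] become invertible over [T] *)

Lemma invertible_mx_map (R R' : pzRingType) (f : {rmorphism R -> R'}) p q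
    (M : 'M[R]_(p, q)) : invertible_mx M -> invertible_mx (map_mx f M).
Proof.
by move=> [N [MN NM]]; exists (map_mx f N); rewrite -!map_mxM MN NM !map_mx1.
Qed.

Lemma invertible_mxM (R : pzRingType) p q r (M : 'M[R]_(p, q)) (N : 'M_(q, r)) :
  invertible_mx M -> invertible_mx N -> invertible_mx (M *m N).
Proof.
move=> [M' [MM' M'M]] [N' [NN' N'N]]; exists (N' *m M'); split.
  by rewrite mulmxA -(mulmxA M) NN' mulmx1.
by rewrite mulmxA -(mulmxA N') M'M mulmx1.
Qed.

Section LocalMatrix.
Context (R K : pzRingType) (t : {rmorphism R -> K}).
Hypothesis local : forall r, t r = 1 -> exists s, r * s = 1.

Let right_inverse_mx m (M : 'M[R]_m) :
  map_mx t M = 1%:M -> exists N, M *m N = 1%:M.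
Proof.
elim: m M => [|m IHm].
  by move=> M _; exists M; rewrite [LHS]flatmx0 [RHS]flatmx0.
rewrite -[m.+1]/(1 + m)%N => M; rewrite -[M]submxK.
set a := ulsubmx M; set b := ursubmx M; set c := dlsubmx M.
set d := drsubmx M => tM.
move: tM; rewrite map_block_mx scalar_mx_block => /eq_block_mx[ta tb tc td].
have [|s as1] := local (r := a 0 0).
  by move/matrixP/(_ 0 0): ta; rewrite !mxE eqxx.
have {as1} as1 : a *m s%:M = 1%:M.
  by rewrite [a]mx11_scalar -scalar_mxM as1.
set ai := s%:M in as1; pose S := d - c *m ai *m b.
have [|N SN] := IHm S.
  by rewrite map_mxB !map_mxM td tc mul0mx mul0mx subr0.
(* [N] inverts the Schur complement [S] of [a], and this is the usual block
   formula for the inverse. *)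
exists (block_mx (ai + ai *m b *m N *m c *m ai) (- (ai *m b *m N))
                 (- (N *m c *m ai)) N).
have dN : d *m N = 1%:M + c *m ai *m b *m N.
  by rewrite -SN mulmxBl subrK.
rewrite mulmx_block scalar_mx_block.
rewrite !(mulmxDr, mulmxN) !mulmxA as1 !mul1mx dN mulmxDl mulmxDl !mul1mx.
congr block_mx.
- by rewrite addrK.
- by rewrite addNr.
- by rewrite opprD addrA addrAC addrK subrr.
- by rewrite addrC addrK.
Qed.

(** A right inverse is also mapped to [1] by [t], so that it has a right inverse
    in its turn. *)
Lemma local_invertible_mx m (M : 'M[R]_m) :
  map_mx t M = 1%:M -> invertible_mx M.
Proof.
move=> tM; have [N MN] := right_inverse_mx tM.
have [|N' NN'] := @right_inverse_mx _ N.
  by rewrite -(map_mx1 t) -MN map_mxM tM mul1mx.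
exists N; split=> //; rewrite -[RHS]NN'; congr (_ *m _).
by rewrite -[M]mulmx1 -NN' mulmxA MN mul1mx.
Qed.
End LocalMatrix.

Section InvertSigma1.
Context (k : fieldType) (n : nat).
Local Notation I := 'I_n.+1.
Local Notation ncpoly := (ncpoly k n).
Local Notation ncseries := (ncseries k n).
Local Notation ratser := (ratser k n).

Lemma scoefX_small (s : ncseries) j w :
  constant_term s = 0 -> (size w < j)%N -> scoef (s ^+ j) w = 0.
Proof.
move=> s0; elim: j w => // j IHj w ltwj; rewrite exprS scoefM big1 // => l _.
case: (posnP l) => [->|l_gt0]; first by rewrite take0 [scoef s _]s0 mul0r.
rewrite IHj ?mulr0 // size_drop.
have := ltn_ord l; lia.
Qed.

(** The inverse is the geometric series in [s = 1 - f]; its coefficient at [w]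
    is that of a partial sum, as [s ^+ j] vanishes on words shorter than [j]. *)
Lemma series_right_inverse (f : ncseries) :
  constant_term f = 1 -> exists h, f * h = 1.
Proof.
move=> f1; pose s := 1 - f.
have s0 : constant_term s = 0 by rewrite rmorphB rmorph1 /= f1 subrr.
pose geom m := \sum_(j < m) s ^+ j.
have geomE m w : (size w < m)%N ->
    scoef (geom m) w = scoef (geom (size w).+1) w.
  rewrite /geom !scoef_sum => ltwm.
  rewrite -!(big_mkord xpredT (fun j => scoef (s ^+ j) w)).
  rewrite (big_cat_nat (n := (size w).+1)) //= -[RHS]addr0; congr (_ + _).
  rewrite big_nat_cond big1 // => j /andP[/andP[lt _] _].
  exact: scoefX_small.
exists (NcSeries (fun w => scoef (geom (size w).+1) w)).
apply/ncseriesP=> w.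
have fgeom : f * geom (size w).+1 = 1 - s ^+ (size w).+1.
  have -> : f = - (s - 1) by rewrite /s opprB subKr.
  by rewrite mulNr -subrX1 opprB.
have -> : scoef 1 w = scoef (f * geom (size w).+1) w.
  by rewrite fgeom scoefD scoefN scoefX_small // subr0.
rewrite !scoefM; apply: eq_bigr => l _; congr (_ * _).
by rewrite [RHS]geomE // ltnS size_drop leq_subr.
Qed.

Lemma ratser_right_inverse (r : ratser) : tau r = 1 -> exists s, r * s = 1.
Proof.
move=> r1; have [h rh] := series_right_inverse (f := ratval r) r1.
have h1 : constant_term h = 1.
  have := congr1 constant_term rh; rewrite rmorphM rmorph1 /=.
  by rewrite [constant_term (ratval r)]r1 mul1r.
have [h' hh'] := series_right_inverse h1.
have h'E : h' = ratval r by rewrite -[h']mul1r -rh -mulrA hh' mulr1.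
rewrite h'E in hh'; exists (RatSer (rational_div (ratvalP r) rh hh')).
exact/val_inj.
Qed.

(** A square matrix [A0 + B] in [Sigma'] is mapped to the invertible [A0] by
    [tau], and [tau] detects invertibility over k_rat<X>. *)
Lemma poly_T_inverts : inverts (poly_T k n) (@Sigma1 k n).
Proof.
move=> p q M [{p q M} m M [A0 [B [A0u B0 ->]]]|]; last first.
  exists (\row_j yT j); split; apply/matrixP=> i j; rewrite !mxE.
    by rewrite big_ord1 !mxE [X in X * _](poly_T_x k i) xT_yT.
  rewrite !ord1 eqxx -[RHS](sum_yT_xT k n); apply: eq_bigr => l _.
  by rewrite !mxE.
have -> : map_mx (nceval xpoly) B = B.
  by apply/matrixP=> i j; rewrite mxE nceval_xpoly.
set P := _ + B.
have -> : map_mx (poly_T k n) P =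
    map_mx (@piT k n \o ratS) (map_mx (@poly_rat k n) P).
  by apply/matrixP=> i j; rewrite !mxE.
apply: invertible_mx_map; set N := map_mx _ P.
pose tauR : {rmorphism ratser -> k} :=
  constant_term \o (\val : ratser -> ncseries).
have tauC (c : k) : tauR c%:A = c by rewrite /= constant_termC.
have tN : map_mx tauR N = A0.
  apply/matrixP=> i j; rewrite !mxE !raddfD /=.
  rewrite [constant_term (poly_series (B i j))]B0 addr0 linearZ /= rmorph1.
  exact: constant_termC.
pose N1 := map_mx (in_alg ratser) (invmx A0) *m N.
have -> : N = map_mx (in_alg ratser) A0 *m N1.
  by rewrite mulmxA -map_mxM mulmxV // map_mx1 mul1mx.
apply: invertible_mxM.
  by apply: invertible_mx_map; exists (invmx A0); rewrite mulmxV ?mulVmx.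
apply: (@local_invertible_mx _ _ tauR) => [r /ratser_right_inverse //|].
rewrite map_mxM tN -(mulVmx A0u); congr (_ *m _).
by apply/matrixP=> i j; rewrite !mxE tauC.
Qed.
End InvertSigma1.

(** * Derivations and hereditary rings *)

Lemma subr_interchange (V : zmodType) (a b c d : V) :
  a - b - (c - d) = a - c - (b - d).
Proof. by rewrite !opprB addrACA [RHS]addrACA [- b - c]addrC. Qed.

Section LinearProjection.
Context (k : fieldType) (R : pzRingType) (eta : {rmorphism k -> R}).
Context (V : lmodType R) (P : V -> Prop).
Hypothesis PD : forall u v, P u -> P v -> P (u + v).
Hypothesis PZ : forall c v, P v -> P (eta c *: v).
Hypothesis P0 : P 0.

(** The empty set is allowed, as the union of an empty chain; hence the passage
    from a maximal [A] to [W] below. *)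
Let free_of_P (A : set V) : Prop :=
  [/\ forall u v, A u -> A v -> A (u + v), forall c v, A v -> A (eta c *: v)
    & forall v, A v -> P v -> v = 0].

(** [rho] is the projection onto [P] along a complement, that is, along a
    subspace maximal among those meeting [P] trivially; [R]-modules are regarded
    here as vector spaces over [k] through [eta]. *)
Lemma linear_projection : exists rho : V -> V,
  [/\ zmod_morphism rho, forall c v, rho (eta c *: v) = eta c *: rho v,
      forall v, P (rho v) & forall v, P v -> rho v = v].
Proof.
have etaV c v : c != 0 -> eta c^-1 *: (eta c *: v) = v.
  by move=> c0; rewrite scalerA -rmorphM mulVf // rmorph1 scale1r.
have PB u v : P u -> P v -> P (u - v).
  move=> Pu Pv; rewrite -scaleN1r -(rmorph1 eta) -rmorphN.
  exact/PD/PZ.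
have [A [[AD AZ AP] Amax]] : exists A, free_of_P A /\
    forall B, (A `<` B)%classic -> ~ free_of_P B.
  apply: Zorn_bigcup => F FP Ftot; split.
  - move=> u v [X FX Xu] [Y FY Yv].
    have [XY|YX] := Ftot X Y FX FY.
      by exists Y => //; have [h _ _] := FP Y FY; apply: h => //; exact: XY.
    by exists X => //; have [h _ _] := FP X FX; apply: h => //; exact: YX.
  - move=> c v [X FX Xv]; exists X => //.
    by have [_ h _] := FP X FX; exact: h.
  - by move=> v [X FX Xv]; have [_ _ h] := FP X FX; exact: h.
pose W v := A v \/ v = 0.
have WD u v : W u -> W v -> W (u + v).
  move=> [Au|->] [Av|->]; rewrite ?addr0 ?add0r.
  - by left; exact: AD.
  - by left.
  - by left.
  - by right.
have WZ c v : W v -> W (eta c *: v).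
  by move=> [Av|->]; [left; exact: AZ | right; rewrite scaler0].
have WP v : W v -> P v -> v = 0 by move=> [/AP|].
have WB u v : W u -> W v -> W (u - v).
  move=> Wu Wv; rewrite -scaleN1r -(rmorph1 eta) -rmorphN.
  exact/WD/WZ.
have split v : exists p, P p /\ W (v - p).
  apply: contrapT => nov.
  apply: (Amax (fun x => exists c w, W w /\ x = w + eta c *: v)).
    split=> [w Aw|Ev].
      by exists 0, w; rewrite rmorph0 scale0r addr0; split=> //; left.
    apply: nov; exists 0; split=> //; rewrite subr0; left; apply: Ev.
    by exists 1, 0; rewrite rmorph1 scale1r add0r; split=> //; right.
  split.
  - move=> _ _ [c [w [Ww ->]]] [c' [w' [Ww' ->]]].
    exists (c + c'), (w + w'); split; first exact: WD.
    by rewrite rmorphD scalerDl addrACA.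
  - move=> c _ [c' [w [Ww ->]]]; exists (c * c'), (eta c *: w).
    by split; [exact: WZ | rewrite scalerDr scalerA rmorphM].
  - move=> _ [c [w [Ww ->]]] Px; have [c0|c0] := eqVneq c 0.
      by move: Px; rewrite c0 rmorph0 scale0r addr0 => /(WP _ Ww).
    case: nov; exists (eta c^-1 *: (w + eta c *: v)); split; first exact: PZ.
    rewrite scalerDr etaV // opprD addrCA subrr addr0 -scalerN.
    by apply: WZ; rewrite -sub0r; apply: WB => //; right.
pose rho v := projT1 (cid (split v)).
have rhoP v : P (rho v) := (projT2 (cid (split v))).1.
have rhoW v : W (v - rho v) := (projT2 (cid (split v))).2.
have rho_eq v p : P p -> W (v - p) -> rho v = p.
  move=> Pp Wp; apply/eqP; rewrite -subr_eq0; apply/eqP/WP; last exact: PB.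
  have -> : rho v - p = (v - p) - (v - rho v).
    by rewrite opprB [RHS]addrC addrA subrK.
  exact: WB.
exists rho; split=> // [u v|c v|v Pv].
- apply: rho_eq; first exact: PB.
  by rewrite subr_interchange; exact: WB.
- by apply: rho_eq; [exact: PZ | rewrite -scalerBr; exact: WZ].
- by apply: rho_eq => //; right; rewrite subrr.
Qed.

End LinearProjection.

Record bimodule (R : pzRingType) := Bimodule {
  bimod :> zmodType;
  lact : R -> bimod -> bimod;
  ract : bimod -> R -> bimod;
  lactDl : forall r s m, lact (r + s) m = lact r m + lact s m;
  lactDr : forall r m m', lact r (m + m') = lact r m + lact r m';
  lactM : forall r s m, lact (r * s) m = lact r (lact s m);
  lact1 : forall m, lact 1 m = m;
  ractDl : forall m m' r, ract (m + m') r = ract m r + ract m' r;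
  ractDr : forall m r s, ract m (r + s) = ract m r + ract m s;
  ractM : forall m r s, ract m (r * s) = ract (ract m r) s;
  ract1 : forall m, ract m 1 = m;
  lractA : forall r m s, lact r (ract m s) = ract (lact r m) s
}.

Definition derivation (R : pzRingType) (N : bimodule R) (d : R -> N) : Prop :=
  (forall r s, d (r + s) = d r + d s) /\
  (forall r s, d (r * s) = lact r (d s) + ract (d r) s).

Section BimoduleTheory.
Context (R : pzRingType) (N : bimodule R).
Implicit Types (r s : R) (m : N).

Lemma lact0 m : lact 0 m = 0.
Proof. by apply: (addrI (lact 0 m)); rewrite -lactDl !addr0. Qed.
Lemma lactr0 r : lact r (0 : N) = 0.
Proof. by apply: (addrI (lact r 0)); rewrite -lactDr !addr0. Qed.
Lemma ract0 r : ract (0 : N) r = 0.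
Proof. by apply: (addrI (ract 0 r)); rewrite -ractDl !addr0. Qed.
Lemma ractr0 m : ract m 0 = 0.
Proof. by apply: (addrI (ract m 0)); rewrite -ractDr !addr0. Qed.
End BimoduleTheory.

Definition op_bimodule (R : pzRingType) (N : bimodule R^c) : bimodule R :=
  @Bimodule R N (fun r m => @ract _ N m r) (fun m r => @lact _ N r m)
    (fun r s m => @ractDr _ N m r s) (fun r m m' => @ractDl _ N m m' r)
    (fun r s m => @ractM _ N m s r) (@ract1 _ N)
    (fun m m' r => @lactDr _ N r m m') (fun m r s => @lactDl _ N r s m)
    (fun m r s => @lactM _ N s r m) (@lact1 _ N)
    (fun r m s => esym (@lractA _ N s m r)).

(** The ring [R + N] in which [N] is an ideal of square zero; derivations
    [R -> N] are the same as ring morphisms [R -> R + N] that lift the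
    identity. *)
Section TrivialExtension.
Context (R : nzRingType) (N : bimodule R).

Definition trivext : Type := (R * N)%type.
HB.instance Definition _ := GRing.Zmodule.on trivext.

Definition te_mul (a b : trivext) : trivext :=
  (a.1 * b.1, lact a.1 b.2 + ract a.2 b.1).

Fact te_mulA : associative te_mul.
Proof.
move=> a b c; congr (_, _); first exact: mulrA.
by rewrite /= !(lactDr, ractDl) lactM ractM lractA addrA.
Qed.
Fact te_mul1 : left_id (1, 0) te_mul.
Proof. by case=> r m; rewrite /te_mul /= mul1r lact1 ract0 addr0. Qed.
Fact te_mulr1 : right_id (1, 0) te_mul.
Proof. by case=> r m; rewrite /te_mul /= mulr1 ract1 lactr0 add0r. Qed.
Fact te_mulDl : left_distributive te_mul +%R.
Proof.
move=> a b c; congr (_, _); first exact: mulrDl.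
by rewrite /= lactDl ractDl addrACA.
Qed.
Fact te_mulDr : right_distributive te_mul +%R.
Proof.
move=> a b c; congr (_, _); first exact: mulrDr.
by rewrite /= lactDr ractDr addrACA.
Qed.
Fact te_one_neq0 : ((1, 0) : trivext) != 0.
Proof. by rewrite xpair_eqE oner_eq0. Qed.

HB.instance Definition _ := GRing.Zmodule_isNzRing.Build trivext
  te_mulA te_mul1 te_mulr1 te_mulDl te_mulDr te_one_neq0.

Definition te_fst (a : trivext) : R := a.1.
Fact te_fst_zmod : zmod_morphism te_fst. Proof. by []. Qed.
HB.instance Definition _ :=
  GRing.isZmodMorphism.Build trivext R te_fst te_fst_zmod.
Fact te_fst_monoid : monoid_morphism te_fst. Proof. by []. Qed.
HB.instance Definition _ :=
  GRing.isMonoidMorphism.Build trivext R te_fst te_fst_monoid.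

Lemma derivation_morph (d : R -> N) : derivation d ->
  exists h : {rmorphism R -> trivext}, forall r, h r = (r, d r).
Proof.
move=> [dD dM]; have [||h hE] := @rmorphism_of R trivext (fun r => (r, d r)).
- move=> r s; congr (_, _); apply/eqP; rewrite eq_sym subr_eq -dD subrK.
  exact: eqxx.
- split=> [|r s]; congr (_, _) => //; apply: (addIr (d 1)); rewrite add0r.
  by have := dM 1 1; rewrite mulr1 lact1 ract1 => <-.
by exists h => r; rewrite hE.
Qed.

Lemma trivext_inl :
  exists h : {rmorphism R -> trivext}, forall r, h r = (r, 0).
Proof.
by apply: derivation_morph; split=> r s; rewrite ?addr0 // lactr0 ract0 addr0.
Qed.

(** An inverse over [R], lifted to [R + N], is an inverse up to a factor [1 + E]
    with [E] over the kernel of the projection; and [(1 + E)(1 - E) = 1] as the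
    kernel has square zero. *)
Lemma trivext_invertible p q (M : 'M[trivext]_(p, q)) :
  invertible_mx (map_mx te_fst M) -> invertible_mx M.
Proof.
move=> [N0 [MN NM]]; have [inl inlE] := trivext_inl.
have sqr0 m (E : 'M[trivext]_m) : map_mx te_fst E = 0 -> E *m E = 0.
  move=> /matrixP E0; apply/matrixP=> i j; rewrite !mxE big1 // => l _.
  have := E0 i l; have := E0 l j; rewrite !mxE /te_fst.
  case: (E i l) (E l j) => [r m1] [s m2] /= -> ->.
  by congr (_, _) => /=; rewrite ?mul0r // lact0 ractr0 addr0.
have unip m (U : 'M[trivext]_m) : map_mx te_fst U = 1%:M ->
    exists U', U *m U' = 1%:M /\ U' *m U = 1%:M.
  move=> U1; have [E -> EE] : exists2 E, U = 1%:M + E & E *m E = 0.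
    exists (U - 1%:M); first by rewrite addrC subrK.
    by apply: sqr0; rewrite map_mxB U1 map_mx1 subrr.
  exists (1%:M - E); rewrite !(mulmxDl, mulmxDr, mulmxN, mulNmx).
  by rewrite !mulmx1 !mul1mx EE oppr0 !addr0 subrK.
pose N1 := map_mx inl N0.
have fN1 : map_mx te_fst N1 = N0.
  by apply/matrixP=> i j; rewrite !mxE inlE.
have [|U [MU _]] := unip _ (M *m N1); first by rewrite map_mxM fN1.
have [|L [_ LM]] := unip _ (N1 *m M); first by rewrite map_mxM fN1.
rewrite -mulmxA in MU; rewrite mulmxA in LM.
exists (N1 *m U); split=> //.
suff -> : N1 *m U = L *m N1 by [].
by rewrite -[LHS]mul1mx -LM -(mulmxA _ M) MU mulmx1.
Qed.

End TrivialExtension.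

(** The bimodule of differentials of [R] over [k] is free on the differentials
    of the [x i].  The values [y i] have to commute with scalars because the
    [x i] are meant to do so. *)
Definition free_derivations (k : fieldType) (R : pzRingType)
    (eta : {rmorphism k -> R}) m (x : 'I_m -> R) : Prop :=
  (forall (N : bimodule R) (y : 'I_m -> N),
     (forall i c, lact (eta c) (y i) = ract (y i) (eta c)) ->
     exists d : R -> N, [/\ derivation d, forall i, d (x i) = y i
       & forall c, d (eta c) = 0]) /\
  (forall (N : bimodule R) (d : R -> N), derivation d ->
     (forall i, d (x i) = 0) -> (forall c, d (eta c) = 0) -> forall r, d r = 0).

(** Exchanging the two actions turns bimodules over the converse ring into
    bimodules over the ring, without changing derivations. *)
Lemma free_derivations_op (k : fieldType) (R : pzRingType)
    (eta : {rmorphism k -> R}) (eta' : {rmorphism k -> R^c}) m (x : 'I_m -> R) :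
  (forall c, eta' c = eta c) ->
  free_derivations eta x -> free_derivations eta' (x : 'I_m -> R^c).
Proof.
move=> etaE [ex uniq].
have op (N : bimodule R^c) (d : R -> N) :
    @derivation R^c N d <-> @derivation R (op_bimodule N) d.
  by split=> -[dD dM]; split=> // r s; rewrite addrC [LHS](dM s r).
split=> [N y yC|N d /op dd dx deta r].
  have [i c|d [dd dx deta]] := ex (op_bimodule N) y.
    by rewrite /= -etaE yC.
  by exists d; split=> [|//|c]; [apply/op | rewrite etaE].
by apply: (uniq (op_bimodule N)) => // c; rewrite -etaE.
Qed.

Section FreeDerivationsT.
Context (k : fieldType) (n : nat).
Local Notation ncpoly := (ncpoly k n).
Local Notation algT := (algT k n).

Lemma poly_TC c : poly_T k n c%:A = c%:A.
Proof. exact: rmorph_alg. Qed.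

(** The morphism from polynomials to [T + N] that sends [x_i] to [(x_i, y_i)]
    inverts [Sigma_1] by [trivext_invertible]; its extension to [T] is
    [(id, d)]. *)
Lemma T_free_derivations : free_derivations (in_alg algT) (@xT k n).
Proof.
split=> [N y yC|N d dd dx deta].
  have [inl inlE] := trivext_inl N.
  pose a i : trivext N := (xT i, y i).
  have [|g [gC gX _]] := @free_eval k n (trivext N) (inl \o in_alg algT) a.
    move=> i c; rewrite /= inlE; congr (_, _) => /=.
      by rewrite mulr_algl mulr_algr.
    by rewrite lactr0 ract0 addr0 add0r -yC.
  have fg p : te_fst (g p) = poly_T k n p.
    apply: (@ncpoly_morph_eq _ _ _ (@te_fst _ N \o g)) p => [c|i].
      by apply: etrans (esym (poly_TC c)); rewrite /= gC /= inlE.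
    by rewrite -[LHS]/(te_fst (g _)) gX.
  have [|h hE] := T_extension (g := g).
    move=> p q M /(poly_T_inverts (k := k) (n := n)) Minv.
    apply: trivext_invertible; congr invertible_mx: Minv.
    by apply/matrixP=> i j; rewrite !mxE fg.
  have fh r : te_fst (h r) = r.
    apply: (@T_morph_eq k n _ (@te_fst _ N \o h) idfun) r => p /=.
    by rewrite hE fg.
  exists (fun r => (h r).2); split=> [|i|c].
  - split=> r s; first by rewrite rmorphD.
    by rewrite rmorphM /= -[(h r).1]/(te_fst _) -[(h s).1]/(te_fst _) !fh.
  - by rewrite -poly_T_x hE gX.
  - have e : h c%:A = inl c%:A by rewrite -{1}poly_TC hE gC.
    by rewrite /= e inlE.
move=> r; have [h hE] := derivation_morph dd.
have [h0 h0E] := trivext_inl N.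
have /(congr1 snd) : h r = h0 r; last by rewrite hE h0E.
apply: T_morph_eq.
apply: (@ncpoly_morph_eq k n _ (h \o poly_T k n) (h0 \o poly_T k n)) => [c|i].
  rewrite -[LHS]/(h (poly_T k n _)) -[RHS]/(h0 (poly_T k n _)) poly_TC.
  by rewrite hE h0E deta.
by rewrite -[LHS]/(h (xT i)) -[RHS]/(h0 (xT i)) hE h0E dx.
Qed.

End FreeDerivationsT.

Section AdditiveMaps.
Context (Q M : zmodType).

Record additive_map := AdditiveMap {
  amap :> Q -> M;
  amapB : zmod_morphism amap
}.

HB.instance Definition _ := gen_eqMixin additive_map.
HB.instance Definition _ := gen_choiceMixin additive_map.

Implicit Types f g h : additive_map.

Lemma amapP f g : (forall q, f q = g q) -> f = g.
Proof.
case: f g => [f fB] [g gB] /= /funext fg; case: g / fg in gB *.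
by rewrite (Prop_irrelevance fB gB).
Qed.

Lemma amap0 f : f 0 = 0.
Proof. by rewrite -(subrr 0) amapB subrr. Qed.
Lemma amapD f q r : f (q + r) = f q + f r.
Proof. by rewrite -{1}[r]opprK amapB -[- r]sub0r amapB amap0 sub0r opprK. Qed.

Fact am_zero_subproof : zmod_morphism (fun _ : Q => 0 : M).
Proof. by move=> q r; rewrite subr0. Qed.
Fact am_opp_subproof f : zmod_morphism (fun q => - f q).
Proof. by move=> q r; rewrite amapB opprD. Qed.
Fact am_add_subproof f g : zmod_morphism (fun q => f q + g q).
Proof. by move=> q r; rewrite !amapB opprD addrACA. Qed.

Definition am_zero := AdditiveMap am_zero_subproof.
Definition am_opp f := AdditiveMap (am_opp_subproof f).
Definition am_add f g := AdditiveMap (am_add_subproof f g).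

Fact am_addA : associative am_add.
Proof. by move=> f g h; apply: amapP => q /=; rewrite addrA. Qed.
Fact am_addC : commutative am_add.
Proof. by move=> f g; apply: amapP => q /=; rewrite addrC. Qed.
Fact am_add0 : left_id am_zero am_add.
Proof. by move=> f; apply: amapP => q /=; rewrite add0r. Qed.
Fact am_addN : left_inverse am_zero am_opp am_add.
Proof. by move=> f; apply: amapP => q /=; rewrite addNr. Qed.

HB.instance Definition _ :=
  GRing.isZmodule.Build additive_map am_addA am_addC am_add0 am_addN.
End AdditiveMaps.

(** The cocycles of the extensions of [Q] by [M] are derivations into this
    bimodule.  For its two actions, a map commutes with the scalars [eta c] when
    it is linear over [k]. *)
Section HomBimodule.
Context (R : pzRingType) (Q M : lmodType R).
Local Notation H := (additive_map Q M).

Fact hom_lact_subproof (r : R) (h : H) : zmod_morphism (fun q => r *: h q).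
Proof. by move=> q q'; rewrite amapB scalerBr. Qed.
Fact hom_ract_subproof (h : H) (r : R) : zmod_morphism (fun q => h (r *: q)).
Proof. by move=> q q'; rewrite scalerBr amapB. Qed.

Definition hom_lact r h : H := AdditiveMap (hom_lact_subproof r h).
Definition hom_ract h r : H := AdditiveMap (hom_ract_subproof h r).

Definition hom_bimodule : bimodule R.
Proof.
refine (@Bimodule R H hom_lact hom_ract _ _ _ _ _ _ _ _ _).
- by move=> r s h; apply: amapP => q /=; rewrite scalerDl.
- by move=> r h h'; apply: amapP => q /=; rewrite scalerDr.
- by move=> r s h; apply: amapP => q /=; rewrite scalerA.
- by move=> h; apply: amapP => q /=; rewrite scale1r.
- by move=> h h' r; apply: amapP.
- by move=> h r s; apply: amapP => q /=; rewrite scalerDl amapD.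
- by move=> h r s; apply: amapP => q /=; rewrite scalerA.
- by move=> h; apply: amapP => q /=; rewrite scale1r.
- by move=> r h s; apply: amapP.
Defined.
End HomBimodule.

Section Hereditary.
Context (k : fieldType) (R : pzRingType) (eta : {rmorphism k -> R}).
Context (m : nat) (x : 'I_m -> R).
Hypothesis eta_central : forall c r, eta c * r = r * eta c.
Hypothesis Rfree : free_derivations eta x.

Lemma linear_section (M N : lmodType R) (g : {linear M -> N}) :
  (forall v, exists u, g u = v) -> exists s : N -> M,
  [/\ zmod_morphism s, forall c v, s (eta c *: v) = eta c *: s v
    & forall v, g (s v) = v].
Proof.
move=> gsurj; have [|||rho [rhoB rhoZ rho_ker rho_id]] :=
  @linear_projection k R eta M (fun u => g u = 0).
- by move=> u v gu gv; rewrite raddfD /= gu gv addr0.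
- by move=> c v gv; rewrite linearZ /= gv scaler0.
- exact: raddf0.
pose pre v := projT1 (cid (gsurj v)).
have preK v : g (pre v) = v := projT2 (cid (gsurj v)).
pose s v := pre v - rho (pre v).
have s_eq u v : g u = v -> s v = u - rho u.
  move=> guv; have: rho (pre v - u) = pre v - u.
    by apply: rho_id; rewrite raddfB /= preK guv subrr.
  rewrite rhoB /s => e; apply/eqP.
  by rewrite -subr_eq0 subr_interchange e subrr.
exists s; split=> [u v|c v|v].
- rewrite (s_eq (pre u - pre v)); last by rewrite raddfB /= !preK.
  by rewrite rhoB subr_interchange.
- rewrite (s_eq (eta c *: pre v)); last by rewrite linearZ /= preK.
  by rewrite rhoZ scalerBr.
- by rewrite raddfB /= rho_ker subr0 preK.
Qed.

(** Let [F : R -> N] extend [f : J -> N] linearly over [k].  The inner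
    derivation [D] of [F] vanishes on [J], and it describes the extension of
    [R / J] by [N] obtained by pushing [J -> R -> R / J] out along [f].  Lifting
    the values of [D] at the [x i] along [g] defines a derivation [d], that is,
    an extension of [R / J] by [M] which lies over the first one.  Lifting the
    generator [1] of [R] to it and restricting to [J] gives [f']; here [m0] is
    the component in [M] of the lifted generator. *)
Lemma free_derivations_hereditary : left_hereditary R.
Proof.
have [ex uniq] := Rfree.
move=> J M N g f gsurj.
have [|||rho [rhoB rhoZ rhoJ rho_id]] :=
  @linear_projection k R eta R^o (fun r => r \in J).
- by move=> r s; exact: rpredD.
- by move=> c r; exact: rpredZ.
- exact: rpred0.
pose F (r : R^o) : N := f (LeftIdeal (rhoJ r)).
have FB : zmod_morphism F.
  move=> r s; rewrite /F -raddfB; congr (f _).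
  by apply/val_inj; rewrite /= rhoB.
have FZ c (r : R^o) : F (eta c *: r) = eta c *: F r.
  by rewrite /F -linearZ; congr (f _); apply/val_inj; rewrite /= rhoZ.
have FJ (j : left_ideal J) : F (val j) = f j.
  by rewrite /F; congr (f _); apply/val_inj; rewrite /= rho_id //; exact: valP.
have FJZ (r : R) (j : left_ideal J) : F (r *: (val j : R^o)) = r *: F (val j).
  by rewrite -[r *: _]/(val (r *: j)) !FJ linearZ.
have [s [sB sZ sK]] := linear_section gsurj.
pose Ff : hom_bimodule R^o N := AdditiveMap FB.
have FD q r : F (q + r) = F q + F r := amapD Ff q r.
have [D DE] : exists D : R -> hom_bimodule R^o N,
    forall r q, D r q = F (r * q) - r *: F q.
  by exists (fun r => ract Ff r - lact r Ff).
have DD r t q : D (r + t) q = D r q + D t q.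
  by rewrite !DE mulrDl scalerDl FD opprD addrACA.
have DM r t q : D (r * t) q = r *: D t q + D r (t * q).
  by rewrite !DE scalerBr scalerA mulrA [RHS]addrC addrA subrK.
have DZ r c q : D r (eta c * q) = eta c *: D r q.
  rewrite !DE mulrA -eta_central -mulrA [F (_ * (r * q))]FZ FZ scalerBr.
  by rewrite !scalerA eta_central.
have Deta c q : D (eta c) q = 0 by rewrite DE FZ subrr.
have DJ r (j : left_ideal J) : D r (val j) = 0 by rewrite DE FJZ subrr.
have Ds r : zmod_morphism (fun q : R^o => s (D r q)).
  by move=> q q'; rewrite amapB sB.
have [|d [[dD dM] dx deta]] :=
    ex (hom_bimodule R^o M) (fun i => AdditiveMap (Ds (x i))).
  by move=> i c; apply: amapP => q /=; rewrite -sZ -DZ.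
have dDE r t q : d (r + t) q = d r q + d t q by rewrite dD.
have dME r t (q : R^o) : d (r * t) q = r *: d t q + d r (t *: q) by rewrite dM.
(* The restriction of [d] to [J] is a derivation into [Hom(J, M)] that vanishes
   at the [x i]; and [g] composed with [d] agrees with [D] at the [x i]. *)
have dJ r (j : left_ideal J) : d r (val j) = 0.
  have resB t : zmod_morphism (fun i : left_ideal J => d t (val i)).
    by move=> i l; rewrite raddfB amapB.
  have := uniq (hom_bimodule (left_ideal J) M) (fun t => AdditiveMap (resB t)).
  move=> /(_ _ _ _ r) /(congr1 (fun h : additive_map _ _ => h j)); apply.
  - by split=> t u; apply: amapP => i /=; rewrite ?dD ?dM.
  - move=> i; apply: amapP => l /=; rewrite dx /= DJ.
    by have := sB 0 0; rewrite !subrr.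
  - by move=> c; apply: amapP => l /=; rewrite deta.
have gd r q : g (d r q) = D r q.
  have gdB t : zmod_morphism (fun p : R^o => g (d t p) - D t p).
    by move=> p p'; rewrite !amapB raddfB subr_interchange.
  have := uniq (hom_bimodule R^o N) (fun t => AdditiveMap (gdB t)).
  move=> /(_ _ _ _ r) /(congr1 (fun h : additive_map _ _ => h q)) e.
  apply/eqP; rewrite -subr_eq0; apply/eqP/e.
  - split=> t u; apply: amapP => p /=.
      by rewrite dDE DD raddfD opprD addrACA.
    by rewrite dME DM raddfD /= linearZ /= opprD addrACA -scalerBr.
  - by move=> i; apply: amapP => p /=; rewrite dx /= sK subrr.
  - by move=> c; apply: amapP => p /=; rewrite deta Deta raddf0 subr0.
have [m0 gm0] := gsurj (F 1).
pose f' (j : left_ideal J) : M := (val j : R) *: m0 + d (val j) (1 : R^o).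
have f'B : zmod_morphism f'.
  move=> j l; rewrite /f' -[val (j - l)]/(val j - val l) scalerBl.
  have -> : d (val j - val l) 1 = d (val j) 1 - d (val l) 1.
    by apply/eqP; rewrite eq_sym subr_eq -dDE subrK.
  by rewrite opprD addrACA.
have f'Z : scalable f'.
  move=> r j; rewrite /f' -[val (r *: j)]/(r * val j) -scalerA dME.
  have -> : d r ((val j : R) *: (1 : R^o)) = 0.
    by rewrite -[RHS](dJ r j); congr (d r _); exact: mulr1.
  by rewrite addr0 scalerDr.
pose addf := GRing.isZmodMorphism.Build _ _ f' f'B.
pose scalef := GRing.isScalable.Build _ _ _ _ f' f'Z.
exists (HB.pack_for {linear left_ideal J -> M} f' addf scalef) => j /=.
rewrite /f' raddfD /= linearZ /= gm0 gd DE.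
have -> : F (val j * 1) = f j by rewrite mulr1 FJ.
by rewrite addrC subrK.
Qed.

End Hereditary.

(** * Conclusions *)

Section Universality.
Context (k : fieldType) (n : nat).
Local Notation ncpoly := (ncpoly k n).
Local Notation algT := (algT k n).

Lemma T_hereditary : hereditary algT.
Proof.
have central (c : k) (t : algT) : c%:A * t = t * c%:A.
  by rewrite mulr_algl mulr_algr.
have free := @T_free_derivations k n.
split.
  exact: (@free_derivations_hereditary k algT (in_alg algT) _ (@xT k n)).
(* Right ideals are left ideals of the converse ring. *)
have [||eta' eta'E] := @rmorphism_of k algT^c (in_alg algT).
- exact: raddfB.
- split=> [|c d]; first exact: (rmorph1 (in_alg algT)).
  by rewrite mulrC; exact: (rmorphM (in_alg algT) d c).
apply: (@free_derivations_hereditary k algT^c eta' _ (@xT k n)) => [c t|].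
  by rewrite eta'E; exact/esym/central.
by apply: free_derivations_op free => c; rewrite eta'E.
Qed.

Lemma T_universal (V : algType k) (a b : 'I_n.+1 -> V) :
  (forall i j, a i * b j = (i == j)%:R) ->
  \sum_(i < n.+1) b i * a i = 1 ->
  (forall (m : nat) (M : 'M[V]_m), Sigma' a m M -> invertible_mx M) ->
  exists psi : {lrmorphism algT -> V},
    ((forall i, psi (xT i) = a i) /\ (forall j, psi (yT j) = b j)) /\
    forall psi' : {lrmorphism algT -> V},
      (forall i, psi' (xT i) = a i) -> (forall j, psi' (yT j) = b j) ->
      psi' =1 psi.
Proof.
move=> ab ba aS.
have [|g [gC gX gE]] := @free_eval k n V (in_alg V) a.
  by move=> i c; rewrite mulr_algl mulr_algr.
have gS : inverts g (@Sigma1 k n).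
  move=> p q M [{p q M} m M [A0 [B [A0u B0 ->]]]|]; last first.
    exists (\row_j b j); split; apply/matrixP=> i j; rewrite !mxE.
      by rewrite big_ord1 !mxE gX ab.
    rewrite !ord1 eqxx -[RHS]ba; apply: eq_bigr => l _.
    by rewrite !mxE gX.
  apply: aS; exists A0, B; split=> //; apply/matrixP=> i j.
  rewrite !mxE rmorphD nceval_xpoly gC; congr (_ + _); exact: gE.
have [h hE] := T_extension gS.
have hZ : scalable h.
  move=> c t; rewrite -mulr_algl rmorphM.
  have -> : h c%:A = c%:A by rewrite -(@poly_TC k n c) hE gC.
  by rewrite mulr_algl.
pose psif : algT -> V := h.
pose addf := GRing.isZmodMorphism.Build algT V psif (rmorphB h).
pose mulf := GRing.isMonoidMorphism.Build algT V psif
  (conj (rmorph1 h) (rmorphM h)).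
pose scalef := GRing.isScalable.Build k algT V _ psif hZ.
pose psi : {lrmorphism algT -> V} :=
  HB.pack_for {lrmorphism algT -> V} psif addf mulf scalef.
have psiX i : psi (xT i) = a i by rewrite -poly_T_x [LHS]hE gX.
exists psi; split; last first.
  move=> psi' psi'X _.
  apply: T_morph_eq => p; rewrite [RHS]hE.
  apply: (@ncpoly_morph_eq k n V (psi' \o poly_T k n) g) => [c|i].
    by rewrite gC -[LHS]/(psi' (poly_T k n c%:A)) poly_TC; exact: rmorph_alg.
  by rewrite gX; exact: psi'X.
split=> // j.
apply: (dual_family_unique (a := a) (b := fun j => psi (yT j))) ba j => i j.
by rewrite -psiX -rmorphM xT_yT rmorph_nat.
Qed.

End Universality.

Theorem theorem7p2 (k : fieldType) (n : nat) (n_gt0 : (0 < n)%N) :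
  [/\ universal_localization (poly_T k n) (@Sigma1 k n),
      hereditary (algT k n)
    & forall (V : algType k) (a b : 'I_n.+1 -> V),
        (forall i j, a i * b j = (i == j)%:R) ->
        \sum_(i < n.+1) b i * a i = 1 ->
        (forall (m : nat) (M : 'M[V]_m), Sigma' a m M -> invertible_mx M) ->
        exists psi : {lrmorphism algT k n -> V},
          ((forall i, psi (xT i) = a i) /\ (forall j, psi (yT j) = b j)) /\
          forall psi' : {lrmorphism algT k n -> V},
            (forall i, psi' (xT i) = a i) -> (forall j, psi' (yT j) = b j) ->
            psi' =1 psi].
Proof.
split; [split; first exact: poly_T_inverts | exact: T_hereditary
  | exact: T_universal].
move=> C g gS; have [h hE] := T_extension gS; exists h; split=> // h' h'E.
by apply: T_morph_eq => p; rewrite h'E hE.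
Qed.
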